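(* Let $Y$ be a dissociated RCE matrix with a fixed AHK representation, and let $h_1,h_2$ be two kernel functions of the same size $p\times q$ with $\mathbb{E}[h_1(Y_{[p],[q]})^2]<\infty$ and $\mathbb{E}[h_2(Y_{[p],[q]})^2]<\infty$. Then for all $m\ge p$ and $n\ge q$, $$\mathrm{Cov}\big(U^{h_1}_{m,n}(Y),U^{h_2}_{m,n}(Y)\big)=\sum_{(0,0)<(r,c)\le(p,q)}\binom{p}{r}^2\binom{q}{c}^2\binom{m}{r}^{-1}\binom{n}{c}^{-1}\mathrm{Cov}\big(p^{r,c}h_1(Y_{[r],[c]}),\,p^{r,c}h_2(Y_{[r],[c]})\big).$$
   Context: Notation: $\mathbb{N}=\{1,2,\dots\}$, $[n]=\{1,\dots,n\}$ with $[0]=\emptyset$, and $\mathcal{P}_k(A)$ is the set of subsets of $A$ of cardinality $k$ (so $\mathcal{P}_0(A)=\{\emptyset\}$). For pairs of integers, $(x,y)\le(x',y')$ means $x\le x'$ and $y\le y'$; $(x,y)<(x',y')$ means in addition $(x,y)\ne(x',y')$. RCE matrices. An infinite real random matrix $Y=(Y_{ij})_{i,j\ge1}$ is row-column exchangeable (RCE) if for all finite permutations $\sigma_1,\sigma_2$ of $\mathbb{N}$, $(Y_{\sigma_1(i)\sigma_2(j)})_{i,j\ge1}$ has the same distribution as $Y$. It is dissociated if for all $m,n$, $(Y_{ij})_{i\le m,j\le n}$ is independent of $(Y_{ij})_{i>m,j>n}$. AHK (Aldous-Hoover-Kallenberg) representation. For a dissociated RCE matrix $Y$ one fixes a measurable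 function $\phi$ and mutually independent families $(\xi_i)_{i\ge1},(\eta_j)_{j\ge1},(\zeta_{ij})_{i,j\ge1}$ of i.i.d. uniform $[0,1]$ variables with $Y_{ij}=\phi(\xi_i,\eta_j,\zeta_{ij})$ almost surely. For $\mathbf{i},\mathbf{j}\subset\mathbb{N}$, $\mathcal{A}_{\mathbf{i},\mathbf{j}}:=\sigma((\xi_i)_{i\in\mathbf{i}},(\eta_j)_{j\in\mathbf{j}},(\zeta_{ij})_{i\in\mathbf{i},j\in\mathbf{j}})$. Kernels and $U$-statistics. A kernel function of size $p\times q$ ($p,q\ge1$) is a measurable $h:\mathcal{M}_{p,q}(\mathbb{R})\to\mathbb{R}$ invariant under permutations of the rows and of the columns of its matrix argument. For $\mathbf{i}\in\mathcal{P}_p(\mathbb{N})$, $\mathbf{j}\in\mathcal{P}_q(\mathbb{N})$, $h(Y_{\mathbf{i},\mathbf{j}})$ is $h$ applied to the submatrix of $Y$ with rows $\mathbf{i}$ and columns $\mathbf{j}$ (in any order). For $m\ge p$, $n\ge q$, $$U^h_{m,n}(Y)=\binom{m}{p}^{-1}\binom{n}{q}^{-1}\sum_{\mathbf{i}\in\mathcal{P}_p([m]),\,\mathbf{j}\in\mathcal{P}_q([n])}h(Y_{\mathbf{i},\mathbf{j}}).$$ Projections. For $0\le r\le p$, $0\le c\le q$, $\mathbf{i}'\in\mathcal{P}_r(\mathbb{N})$, $\mathbf{j}'\in\mathcal{P}_c(\mathbb{N})$, $\psi^{r,c}h(Y_{\mathbf{i}',\mathbf{j}'}):=\mathbb{E}[h(Y_{\mathbf{i},\mathbf{j}})\mid\mathcal{A}_{\mathbf{i}',\mathbf{j}'}]$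 for any $\mathbf{i}\in\mathcal{P}_p(\mathbb{N})$, $\mathbf{j}\in\mathcal{P}_q(\mathbb{N})$ with $\mathbf{i}'\subset\mathbf{i}$, $\mathbf{j}'\subset\mathbf{j}$ (the choice does not matter; this is only a notation, not a function of $Y_{\mathbf{i}',\mathbf{j}'}$, and makes sense also if $\mathbf{i}'$ or $\mathbf{j}'$ is empty). Recursively, $$p^{r,c}h(Y_{\mathbf{i},\mathbf{j}})=\psi^{r,c}h(Y_{\mathbf{i},\mathbf{j}})-\sum_{(0,0)\le(r',c')<(r,c)}\ \sum_{\mathbf{i}'\in\mathcal{P}_{r'}(\mathbf{i}),\,\mathbf{j}'\in\mathcal{P}_{c'}(\mathbf{j})}p^{r',c'}h(Y_{\mathbf{i}',\mathbf{j}'})$$ for $\mathbf{i}\in\mathcal{P}_r(\mathbb{N})$, $\mathbf{j}\in\mathcal{P}_c(\mathbb{N})$; in particular $p^{0,0}h=\mathbb{E}[h(Y_{[p],[q]})]$. *)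

(* Defs.v *)
From HB Require Import structures.
From mathcomp Require Import all_boot all_order all_algebra finmap perm.
From mathcomp Require Import boolp classical_sets functions cardinality fsbigop.
From mathcomp Require Import reals ereal topology normedtype sequences measure.
From mathcomp Require Import lebesgue_measure lebesgue_integral probability.
From mathcomp Require Import charge measurable_realfun.

Set Implicit Arguments.
Unset Strict Implicit.
Unset Printing Implicit Defensive.

Import Order.TTheory GRing.Theory Num.Theory.
Import numFieldNormedType.Exports.

Local Open Scope classical_set_scope.
Local Open Scope ring_scope.

(** Row and column indices are natural numbers starting from 0, so that the
    set [n] of the first [n] indices is {0, ..., n - 1}. *)
Definition upto (n : nat) : {fset nat} := [fset i in iota 0 n]%fset.

Definition ksubsets (k : nat) (A : {fset nat}) : {fset {fset nat}} :=
  [fset I in fpowerset A | #|` I| == k]%fset.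

(** The sigma-algebra generated by the real functions [X i], [i \in D]. *)
Definition sigma_gen (R : realType) (I U : Type) (D : set I)
    (X : I -> U -> R) : set (set U) :=
  <<s \bigcup_(i in D) preimage_set_system setT (X i) measurable >>.

Section Independence.
Context d (T : measurableType d) (R : realType) (P : probability T R).

Definition independent_sigma (F G : set (set T)) : Prop :=
  forall A B, F A -> G B -> P (A `&` B) = (P A * P B)%E.

Definition mutually_independent (I : choiceType) (X : I -> T -> R) : Prop :=
  forall (S : {fset I}) (B : I -> set R), (forall i, measurable (B i)) ->
    P (\bigcap_(i in [set` S]) (X i @^-1` B i)) =
    (\prod_(i <- S) P (X i @^-1` B i))%E.

Definition uniform01 (X : T -> R) : Prop :=
  forall B : set R, measurable B -> P (X @^-1` B) = uniform_prob (@ltr01 R) B.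

(** [Z] is a version of the conditional expectation of [X] given [G]. *)
Definition is_cond_exp (G : set (set T)) (X Z : T -> R) : Prop :=
  [/\ forall B : set R, measurable B -> G (Z @^-1` B),
      P.-integrable setT (EFin \o Z) &
      forall A, G A ->
        (\int[P]_(w in A) (Z w)%:E = \int[P]_(w in A) (X w)%:E)%E].

End Independence.

(** Every integrable variable has a conditional expectation. *)
Lemma cond_exp_exists d (T : measurableType d) (R : realType)
    (P : probability T R) (S : set (set T)) (X : T -> R) :
  S `<=` measurable -> P.-integrable setT (EFin \o X) ->
  exists Z, is_cond_exp P <<s S >> X Z.
Proof.
move=> Sm iX.
have GM : <<s S >> `<=` @measurable _ T.
  by apply: smallest_sub => //; exact: sigma_algebra_measurable.
pose T' : measurableType _ := g_sigma_algebraType S.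
have mi : measurable_fun setT (idfun : T -> T').
  by move=> _ A mA; rewrite setTI; exact: GM.
pose i : {mfun T >-> T'} :=
  HB.pack (idfun : T -> T') (isMeasurableFun.Build _ _ _ _ _ mi).
pose P' : probability T' R := distribution P i.
pose nu0 : {charge set T -> \bar R} := induced_charge iX.
have mi' : measurable_fun setT (i : T -> T') := mi.
pose nu := measure_function_pushforward__canonical__charge_Charge nu0 mi'.
have numu : nu `<< P'.
  apply: (@dominates_pushforward _ _ _ _ R P nu0 i mi').
  apply/null_content_dominatesP => A mA PA0.
  apply: null_set_integral => //.
  by apply: measurable_funTS; exact: measurable_int iX.
pose f := Radon_Nikodym nu P'.
have ff x : f x \is a fin_num by exact: Radon_Nikodym_fin_num.
have intf : P'.-integrable setT f by exact: Radon_Nikodym_integrable.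
have mf : measurable_fun setT f by exact: measurable_int intf.
have efine : EFin \o (fun w => fine (f w)) = f.
  by apply/funext => w /=; rewrite fineK.
have intP : P.-integrable setT (f : T -> \bar R).
  apply/integrableP; split.
    by apply: (measurableT_comp mf mi').
  move/integrableP : intf => [_].
  rewrite ge0_integral_pushforward//.
  exact: measurableT_comp.
exists (fun w => fine (f w)); split.
- move=> B mB.
  have mz : measurable_fun setT (fine \o f) by apply: measurableT_comp.
  by have := mz measurableT B mB; rewrite setTI.
- by rewrite efine.
- move=> A GA.
  transitivity (\int[P]_(w in A) f w)%E.
    by apply: eq_integral => w _; rewrite fineK.
  have := @Radon_Nikodym_integral _ _ R nu P' A numu GA.
  rewrite -/f (@integral_pushforward _ _ _ _ R i mi' P A f mf)//.
  by apply: integrableS intP => //; exact: GM.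
Qed.

Definition finite_perm (s : nat -> nat) : Prop :=
  bijective s /\ exists N, forall i, (N <= i)%N -> s i = i.

Section RandomMatrix.
Context d (T : measurableType d) (R : realType) (P : probability T R).
Variable Y : nat -> nat -> T -> R.

(** The law of an infinite matrix lives on the product sigma-algebra, the one
    generated by the entries. *)
Definition RCE : Prop :=
  forall s1 s2 : nat -> nat, finite_perm s1 -> finite_perm s2 ->
  forall B : set (nat * nat -> R),
    sigma_gen setT (fun (k : nat * nat) (y : nat * nat -> R) => y k) B ->
    P [set w | B (fun k => Y (s1 k.1) (s2 k.2) w)] =
    P [set w | B (fun k => Y k.1 k.2 w)].

Definition dissociated : Prop :=
  forall m n : nat,
    independent_sigma P
      (sigma_gen [set k : nat * nat | (k.1 < m)%N /\ (k.2 < n)%N]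
                 (fun k => Y k.1 k.2))
      (sigma_gen [set k : nat * nat | (m <= k.1)%N /\ (n <= k.2)%N]
                 (fun k => Y k.1 k.2)).

End RandomMatrix.

Section AHK.
Context d (T : measurableType d) (R : realType) (P : probability T R).
Variables (xi eta : nat -> T -> R) (zeta : nat -> nat -> T -> R).

Definition ahk_var (k : nat + nat + nat * nat) : T -> R :=
  match k with
  | inl (inl i) => xi i
  | inl (inr j) => eta j
  | inr (i, j) => zeta i j
  end.

Definition AHK_representation (Y : nat -> nat -> T -> R)
    (phi : R * R * R -> R) : Prop :=
  [/\ measurable_fun setT phi,
      forall k, measurable_fun setT (ahk_var k),
      forall k, uniform01 P (ahk_var k),
      mutually_independent P ahk_var &
      forall i j,
        {ae P, forall w, Y i j w = phi (xi i w, eta j w, zeta i j w)}].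

Definition ahk_sigma (I J : {fset nat}) : set (set T) :=
  sigma_gen
    [set k | match k with
             | inl (inl i) => i \in I
             | inl (inr j) => j \in J
             | inr (i, j) => (i \in I) && (j \in J)
             end]
    ahk_var.

End AHK.

Section Kernel.
Context (R : realType) (p q : nat).

Definition kernel_function (h : 'M[R]_(p, q) -> R) : Prop :=
  (forall B : set R, measurable B ->
     sigma_gen setT (fun (k : 'I_p * 'I_q) (M : 'M[R]_(p, q)) => M k.1 k.2)
       (h @^-1` B)) /\
  (forall (s : 'S_p) (t : 'S_q) (M : 'M[R]_(p, q)),
     h (row_perm s (col_perm t M)) = h M).

Context (T : Type).
Variables (h : 'M[R]_(p, q) -> R) (Y : nat -> nat -> T -> R).

(** For a kernel [h] the order in which [I] and [J] are enumerated does not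
    matter. *)
Definition kernel_at (I J : {fset nat}) (w : T) : R :=
  h (\matrix_(k < p, l < q)
       Y (nth 0%N (enum_fset I) k) (nth 0%N (enum_fset J) l) w).

Definition Ustat (m n : nat) (w : T) : R :=
  'C(m, p)%:R^-1 * 'C(n, q)%:R^-1 *
  \sum_(I <- ksubsets p (upto m)) \sum_(J <- ksubsets q (upto n))
    kernel_at I J w.

End Kernel.

(** [psi I' J'] is a version of E[h(Y_{I,J}) | A_{I',J'}]. Neither the version
    nor the index sets [I] and [J] containing [I'] and [J'] is prescribed. *)
Definition is_psi d (T : measurableType d) (R : realType) (P : probability T R)
    (xi eta : nat -> T -> R) (zeta : nat -> nat -> T -> R) (p q : nat)
    (h : 'M[R]_(p, q) -> R) (Y : nat -> nat -> T -> R)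
    (psi : {fset nat} -> {fset nat} -> T -> R) : Prop :=
  forall I' J' : {fset nat}, (#|` I'| <= p)%N -> (#|` J'| <= q)%N ->
  exists I J : {fset nat},
    [/\ (I' `<=` I)%fset /\ #|` I| = p, (J' `<=` J)%fset /\ #|` J| = q &
        is_cond_exp P (ahk_sigma xi eta zeta I' J') (kernel_at h Y I J)
          (psi I' J')].

Section Projection.
Context (T : Type) (R : realType).
Variable psi : {fset nat} -> {fset nat} -> T -> R.

(** The number [k] bounds the depth of the recursion; [r + c] is enough since
    [r' + c' < r + c] in every recursive call. *)
Fixpoint pproj_rec (k r c : nat) (I J : {fset nat}) (w : T) : R :=
  psi I J w -
  (if k is k'.+1 then
     \sum_(r' < r.+1) \sum_(c' < c.+1 | (r' : nat, c' : nat) != (r, c))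
       \sum_(I' <- ksubsets r' I) \sum_(J' <- ksubsets c' J)
         pproj_rec k' r' c' I' J' w
   else 0).

Definition pproj (r c : nat) := pproj_rec (r + c) r c.

Lemma ord_pair_neq_lt r c (r' : 'I_r.+1) (c' : 'I_c.+1) :
  (r' : nat, c' : nat) != (r, c) -> (r' + c' < r + c)%N.
Proof.
move=> ne; rewrite ltn_neqAle leq_add ?andbT -1?ltnS ?ltn_ord//.
apply: contraNneq ne => e; apply/eqP.
have := ltn_ord r'; have := ltn_ord c'; rewrite !ltnS => lc lr.
have er : r' = r :> nat.
  apply/eqP; rewrite eqn_leq lr/= -(leq_add2r c) -e leq_add2l//.
by congr pair => //; move/eqP: e; rewrite er eqn_add2l => /eqP.
Qed.

Lemma pproj_rec_stable k r c I J w : (r + c <= k)%N ->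
  pproj_rec k r c I J w = pproj r c I J w.
Proof.
suff H : forall n k l r c I J, (r + c <= n)%N -> (r + c <= k)%N ->
    (r + c <= l)%N -> pproj_rec k r c I J w = pproj_rec l r c I J w.
  by move=> h; apply: (H (r + c)%N).
elim=> [|n IH] {}k l {}r {}c {}I {}J.
  rewrite leqn0 addn_eq0 => /andP[/eqP -> /eqP ->] _ _.
  by case: k => [|k]; case: l => [|l] //=; rewrite !bigop.big_ord1 !big_ord1_cond eqxx.
move=> hn hk hl.
have [/eqP|rc0] := posnP (r + c).
  rewrite addn_eq0 => /andP[/eqP er /eqP ec]; apply: IH; by rewrite er ec.
case: k hk => [|k] hk; first by rewrite leqNgt rc0 in hk.
case: l hl => [|l] hl; first by rewrite leqNgt rc0 in hl.
rewrite /=; congr (_ - _); apply: eq_bigr => r' _; apply: eq_bigr => c' ne.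
have lt := ord_pair_neq_lt ne.
apply: eq_bigr => I' _; apply: eq_bigr => J' _.
by apply: IH; rewrite -ltnS; apply: leq_trans lt _.
Qed.

Lemma pprojE r c I J w :
  pproj r c I J w = psi I J w -
    \sum_(r' < r.+1) \sum_(c' < c.+1 | (r' : nat, c' : nat) != (r, c))
      \sum_(I' <- ksubsets r' I) \sum_(J' <- ksubsets c' J)
        pproj r' c' I' J' w.
Proof.
rewrite -(pproj_rec_stable I J w (leqnSn (r + c)%N)) /=; congr (_ - _).
apply: eq_bigr => r' _; apply: eq_bigr => c' ne.
apply: eq_bigr => I' _; apply: eq_bigr => J' _.
by apply: pproj_rec_stable; apply: ltnW; exact: ord_pair_neq_lt.
Qed.

End Projection.

(* Main.v *)
Require Import Defs.
From HB Require Import structures.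
From mathcomp Require Import all_boot all_order all_algebra finmap perm.
From mathcomp Require Import boolp classical_sets functions cardinality fsbigop.
From mathcomp Require Import reals ereal topology normedtype sequences measure.
From mathcomp Require Import lebesgue_measure lebesgue_integral probability.
From mathcomp Require Import numfun measurable_realfun simple_functions exp hoelder.
From mathcomp Require Import zify ring lra.

(** The covariance of [psi1 I J] and [psi2 I' J'] depends only on the sizes of the
    intersections of [I], [I'] and of [J], [J']. First, by independence of the AHK
    variables, [E[psi2 I' J' | A_{I,J}]] is the projection on the common indices, so both
    arguments may be replaced by their projections there. Second, enlarging these common
    indices by disjoint fresh ones turns the projections back into two kernels, whose joint
    law is unchanged by injective reindexings of the AHK variables.

    Since [psi I J] is the sum of the projections [p^{r',c'}] over the subsets of [I] and
    [J], Moebius inversion on the lattice of pairs of subsets then shows that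
    [p^{r,c} h1] and [p^{r',c'} h2] at different index sets are uncorrelated, and that the
    covariance at the same index sets depends on [(r, c)] only. The formula follows by
    counting in how many ways two sets of size [p] both contain a given set of size [r]. *)

Set Implicit Arguments.
Unset Strict Implicit.
Unset Printing Implicit Defensive.

Import Order.TTheory GRing.Theory Num.Theory.
Import numFieldNormedType.Exports.

Local Open Scope classical_set_scope.
Local Open Scope ring_scope.

(** * Conditional expectations of square-integrable variables *)

(** The obstacle is that the data are given only up to choices. [psi1] and [psi2] are arbitrary
    versions over unspecified index sets, and [Y] is a function of the AHK variables only almost
    surely, so [kernel_at h Y I J] need not be measurable for the sigma-algebra of [I] and [J],
    which is not completed by null sets. Hence everything passes through [ahk_kernel], defined
    pointwise from [phi], and [psi_version], which quantifies over all supersets of full size. A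
    kernel over full-size sets is then its own projection, so one covariance function [G] serves
    both the projections and the U-statistics. A version is only known to be integrable, so its
    square integrability has to be proved before any covariance is computed. The projections
    [p^{r,c}] are never conditioned: their orthogonality is extracted algebraically from double sums
    of covariances. The term (0, 0) disappears because the sigma-algebra of empty index sets is
    trivial. *)

Section generated_measurability.
Context (T : pointedType) (S : set (set T)).

(** Turns the preimage condition of [is_cond_exp] into measurability on the type carrying the
    generated sigma-algebra, where the usual closure properties apply. *)
Lemma gen_measurable_fun d' (U : measurableType d') (V : T -> U) :
  (forall B, measurable B -> <<s S >> (V @^-1` B)) ->
  measurable_fun (setT : set (g_sigma_algebraType S)) V.
Proof. by move=> mV _ B mB; rewrite setTI; exact: mV. Qed.

Lemma gen_measurable_funP d' (U : measurableType d') (V : T -> U) :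
  measurable_fun (setT : set (g_sigma_algebraType S)) V ->
  forall B, measurable B -> <<s S >> (V @^-1` B).
Proof. by move=> mV B mB; have := mV measurableT B mB; rewrite setTI. Qed.

End generated_measurability.

Section cond_exp_theory.
Context d (T : measurableType d) (R : realType) (P : probability T R).
Variable S : set (set T).
Hypothesis Sm : S `<=` measurable.

Let TS : measurableType _ := g_sigma_algebraType S.

Lemma gen_sub_measurable : <<s S >> `<=` @measurable _ T.
Proof. by apply: smallest_sub => //; exact: sigma_algebra_measurable. Qed.

Lemma gen_measurable_funW d' (U : measurableType d') (V : T -> U) :
  measurable_fun (setT : set TS) V -> measurable_fun (setT : set T) V.
Proof.
by move=> mV _ B mB; rewrite setTI; apply: gen_sub_measurable;
  exact: gen_measurable_funP.
Qed.

Section orthogonal.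
Variable D : T -> R.
Hypothesis iD : P.-integrable setT (EFin \o D).
Hypothesis D0 : forall A, <<s S >> A -> (\int[P]_(w in A) (D w)%:E = 0)%E.

Import HBSimple HBNNSimple.

Let nnsfun_mul_int (f : {nnsfun TS >-> R}) :
  (\int[P]_w (f w * D w)%:E = 0)%E.
Proof.
have mf y : <<s S >> (f @^-1` [set y]).
  by apply: gen_measurable_funP => //; exact: measurable_set1.
have mfT y : @measurable _ T (f @^-1` [set y]) by exact: gen_sub_measurable.
transitivity (\int[P]_w \sum_(y <- fset_set (range f))
    (y%:E * ((D w)%:E * (\1_(f @^-1` [set y]) w)%:E)))%E.
  apply: eq_integral => w _; rewrite fimfunE fsbig_finite//=.
  rewrite mulr_suml -sumEFin; apply: eq_bigr => y _.
  by rewrite -!EFinM mulrAC mulrA.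
have intI y : P.-integrable setT
    (fun w => (D w)%:E * (\1_(f @^-1` [set y]) w)%:E)%E.
  rewrite (_ : (fun _ => _) = ((EFin \o D) \_ (f @^-1` [set y]))); last first.
    by apply/funext => w; rewrite epatch_indic.
  by apply/(integrable_mkcond _ (mfT y)); exact: integrableS iD.
rewrite integral_sum//; last by move=> y; apply: integrableZl.
rewrite big1// => y _; rewrite integralZl//.
rewrite (_ : \int[P]_w _ = 0)%E ?mule0//.
have := D0 (mf y); rewrite integral_mkcond => <-.
by apply: eq_integral => w _; rewrite epatch_indic.
Qed.

(** Simple functions increase to [V] and their products with [D] are dominated by [|V D|]. So
    integrability of the product suffices, and [V] may be unbounded. *)
Let ge0_mul_int (V : T -> R) : (forall w, 0 <= V w) ->
  measurable_fun (setT : set TS) V ->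
  P.-integrable setT (fun w => (V w * D w)%:E) ->
  (\int[P]_w (V w * D w)%:E = 0)%E.
Proof.
move=> V0 mV iVD.
have mVE : measurable_fun (setT : set TS) (EFin \o V) by exact/measurable_EFinP.
pose f := nnsfun_approx measurableT mVE.
have mD : measurable_fun setT D by apply/measurable_EFinP; exact: measurable_int iD.
have fV w : EFin \o f^~ w @ \oo --> (V w)%:E.
  by apply: (cvg_nnsfun_approx measurableT mVE) => // x _; rewrite lee_fin.
have [|||||_ _] := @dominated_convergence _ T R P _ measurableT
    (fun n w => (f n w * D w)%:E) (fun w => (V w * D w)%:E)
    (fun w => `|(V w * D w)%:E|%E).
- move=> n; apply/measurable_EFinP; apply: measurable_funM => //.
  by apply: gen_measurable_funW.
- exact: measurable_int iVD.
- apply: aeW => w _.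
  under eq_fun do rewrite EFinM; rewrite EFinM.
  by apply: cvgeZr => //; exact: fV.
- exact: integrable_abse.
- apply: aeW => w n _; rewrite !abse_EFin lee_fin !normrM.
  apply: ler_wpM2r => //; rewrite !ger0_norm//.
  rewrite -lee_fin /f nnsfun_approxE.
  by apply: le_approx => // x; rewrite lee_fin.
rewrite (_ : [sequence _]_n = cst 0%E); last first.
  by apply/funext => n /=; exact: nnsfun_mul_int.
by move/cvg_lim => <- //; rewrite lim_cst.
Qed.

Lemma gen_mul_int0 (V : T -> R) : measurable_fun (setT : set TS) V ->
  P.-integrable setT (fun w => (V w * D w)%:E) ->
  (\int[P]_w (V w * D w)%:E = 0)%E.
Proof.
move=> mV iVD.
have mD : measurable_fun setT D by apply/measurable_EFinP; exact: measurable_int iD.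
have mp := measurable_funrpos mV; have mn := measurable_funrneg mV.
have ip : P.-integrable setT (fun w => (V^\+%R w * D w)%:E).
  apply: le_integrable iVD => //.
    by apply/measurable_EFinP; apply: measurable_funM => //; exact: gen_measurable_funW.
  move=> w _; rewrite !abse_EFin lee_fin !normrM ler_wpM2r//.
  by rewrite ger0_norm ?funrpos_ge0// /funrpos ge_max ler_norm normr_ge0.
have im : P.-integrable setT (fun w => (V^\-%R w * D w)%:E).
  apply: le_integrable iVD => //.
    by apply/measurable_EFinP; apply: measurable_funM => //; exact: gen_measurable_funW.
  move=> w _; rewrite !abse_EFin lee_fin !normrM ler_wpM2r//.
  by rewrite ger0_norm ?funrneg_ge0// /funrneg ge_max -normrN ler_norm normr_ge0.
under eq_integral => w _.
  rewrite (_ : V w = V^\+%R w - V^\-%R w); last first.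
    by rewrite -[RHS]/((V^\+ - V^\-)%R w) funrposBneg.
  rewrite mulrBl EFinB; over.
rewrite integralB// !ge0_mul_int ?sube0//.
Qed.

End orthogonal.
End cond_exp_theory.

Section cond_exp_square.
Context d (T : measurableType d) (R : realType) (P : probability T R).

Lemma Lfun_sqr_lty (X : T -> R) : measurable_fun setT X ->
  ('E_P[(fun w => X w ^+ 2)%R] < +oo)%E -> X \in Lfun P 2%:E.
Proof.
move=> mX X2; rewrite inE; apply/andP; split; rewrite inE//=.
rewrite /finite_norm unlock; apply: poweR_lty.
move: X2; rewrite unlock; apply: le_lt_trans.
rewrite le_eqVlt; apply/orP; left; apply/eqP; apply: eq_integral => w _.
by rewrite /= powR_mulrn// -normrX ger0_norm ?sqr_ge0.
Qed.

Lemma Lfun_measurable (X : T -> R) (p : \bar R) : X \in Lfun P p ->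
  measurable_fun setT X.
Proof. by rewrite inE => /andP[]; rewrite inE. Qed.

Lemma Lfun21 (X : T -> R) : X \in Lfun P 2%:E -> X \in Lfun P 1.
Proof. by apply: Lfun_subset12; exact: fin_num_measure. Qed.

Variable S : set (set T).
Hypothesis Sm : S `<=` measurable.
Let TS : measurableType _ := g_sigma_algebraType S.

Lemma cond_exp_gen_measurable (X Z : T -> R) :
  is_cond_exp P <<s S >> X Z -> measurable_fun (setT : set TS) Z.
Proof. by case=> mZ _ _; exact: gen_measurable_fun. Qed.

(** The difference [Z - X] integrates to 0 over each set of the sigma-algebra, hence against each
    [V] measurable for it. *)
Lemma cond_exp_mul (X Z V : T -> R) : is_cond_exp P <<s S >> X Z ->
  P.-integrable setT (EFin \o X) -> measurable_fun (setT : set TS) V ->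
  P.-integrable setT (EFin \o (V \* X)) ->
  P.-integrable setT (EFin \o (V \* Z)) ->
  ('E_P[(V \* Z)%R] = 'E_P[(V \* X)%R])%E.
Proof.
move=> [mZ iZ XZ] iX mV iVX iVZ.
have iD : P.-integrable setT (EFin \o (Z \- X)).
  by rewrite (_ : _ \o _ = (EFin \o Z) \- (EFin \o X))%E//; exact: integrableB.
have D0 A : <<s S >> A -> (\int[P]_(w in A) ((Z \- X) w)%:E = 0)%E.
  move=> SA; have mA := gen_sub_measurable Sm SA.
  under eq_integral do rewrite EFinB.
  rewrite integralB//=; [|exact: integrableS iZ|exact: integrableS iX].
  rewrite XZ// subee//; apply: integrable_fin_num => //.
  exact: integrableS iX.
have VDE : (fun w => (V w * (Z \- X) w)%:E) =
    ((EFin \o (V \* Z)%R) \- (EFin \o (V \* X)%R))%E.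
  by apply/funext => w; rewrite /= mulrBr.
have iVD : P.-integrable setT (fun w => (V w * (Z \- X) w)%:E).
  by rewrite VDE; exact: integrableB.
have := gen_mul_int0 Sm iD D0 mV iVD.
rewrite VDE integralB// !unlock => /eqP; rewrite sube_eq ?add0e//.
- by move/eqP.
- by apply: integrable_fin_num.
Qed.

(** [Z] cannot be its own multiplier in [cond_exp_mul], since [Z ^ 2] is not yet known to be
    integrable. A truncation is bounded and still measurable for the sub-sigma-algebra. *)
Lemma cond_exp_Lfun2 (X Z : T -> R) : is_cond_exp P <<s S >> X Z ->
  X \in Lfun P 2%:E -> Z \in Lfun P 2%:E.
Proof.
move=> XZ X2; have [_ iZ _] := XZ.
have mZS := cond_exp_gen_measurable XZ.
have mZ := gen_measurable_funW Sm mZS.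
have iX : P.-integrable setT (EFin \o X) by exact/Lfun1_integrable/Lfun21.
have mX := Lfun_measurable X2.
apply: Lfun_sqr_lty => //.
(* [E[V n ^ 2] = E[V n X]] for the truncation [V n] of [Z], hence
   [0 <= E[(V n - X) ^ 2] = E[X ^ 2] - E[V n ^ 2]]. *)
pose V (n : nat) w := if `|Z w| <= n%:R then Z w else 0.
have VE n w : V n w = if `|Z w| <= n%:R then Z w else 0 by [].
have mVS n : measurable_fun (setT : set TS) (V n).
  apply: measurable_fun_ifT => //.
  by apply: measurable_fun_ler => //; exact: measurableT_comp.
have Vn n w : `|V n w| <= n%:R by rewrite VE; case: ifPn => // _; rewrite normr0.
have VV n : (V n \* Z = V n \* V n).
  by apply/funext => w /=; rewrite !VE; case: ifPn => //; rewrite !mul0r.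
have mVn n := gen_measurable_funW Sm (mVS n).
have V1 n (f : T -> R) : P.-integrable setT (EFin \o f) ->
    P.-integrable setT (EFin \o (V n \* f)).
  move=> f1; apply: (le_integrable _ _ _ (integrableZl measurableT n%:R f1)) => //.
    apply/measurable_EFinP; apply: measurable_funM => //.
    by apply/measurable_EFinP; exact: measurable_int f1.
  move=> w _; rewrite /= lee_fin !normrM; apply: ler_wpM2r => //.
  by rewrite (ger0_norm (ler0n _ _)).
have Vsqr n : ('E_P[(V n \* V n)%R] <= 'E_P[(X \* X)%R])%E.
  have VX1 : V n \* X \in Lfun P 1 by exact/Lfun1_integrable/V1.
  have VV1 : V n \* V n \in Lfun P 1.
    by apply/Lfun1_integrable; rewrite -VV; exact: V1.
  have XX1 : X \* X \in Lfun P 1 by exact: Lfun2_mul_Lfun1.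
  have EVX : ('E_P[(V n \* V n)%R] = 'E_P[(V n \* X)%R])%E.
    by rewrite -VV; apply: cond_exp_mul XZ _ _ _ _ => //; exact: V1.
  have := @expectation_ge0 _ _ _ P (fun w => (V n w - X w) ^+ 2) (fun w => sqr_ge0 _).
  rewrite (_ : (fun _ => _) = (V n \* V n \- 2 \o* (V n \* X)) \+ X \* X); last first.
    by apply/funext => w /=; ring.
  have VX2 : 2 \o* (V n \* X) \in Lfun P 1 by rewrite Lfun_scale.
  rewrite expectationD//; last by rewrite rpredB.
  rewrite expectationB// expectationZl// -EVX.
  rewrite -(fineK (expectation_fin_num VV1)) -(fineK (expectation_fin_num XX1)).
  by rewrite -EFinM -EFinB -EFinD !lee_fin => ?; lra.
(* The squared truncations increase to [Z ^ 2], so monotone convergence carries the bound by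
   E[X ^ 2] to the limit. *)
have ndV : forall w, setT w -> nondecreasing_seq (fun n => (V n w ^+ 2)%:E).
  move=> w _ k n kn; rewrite lee_fin !VE; case: ifPn => Zk; last by rewrite expr0n sqr_ge0.
  by rewrite (le_trans Zk) ?ler_nat.
have VZ w : (V n w ^+ 2)%:E @[n --> \oo] --> (Z w ^+ 2)%:E.
  apply: cvg_near_cst; near=> n; rewrite VE ifT//.
  near: n; exact: nbhs_infty_ger.
have := @cvg_monotone_convergence _ T R P setT measurableT
  (fun n w => (V n w ^+ 2)%:E) _ (fun n w _ => sqr_ge0 _) ndV.
move=> /(_ _)/cvge_to_le => H.
apply: (@le_lt_trans _ _ ('E_P[(X \* X)%R]%E)); last first.
  by rewrite ltey_eq expectation_fin_num// Lfun2_mul_Lfun1.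
rewrite unlock (_ : \int[P]_w _ = \int[P]_w (limn (fun n => (V n w ^+ 2)%:E)))%E; last first.
  by apply: eq_integral => w _; apply/esym/cvg_lim => //; exact: VZ.
apply: H.
  by move=> n; apply/measurable_EFinP; exact: measurable_funX.
by apply: nearW => n; have := Vsqr n; rewrite unlock.
Unshelve. all: by end_near. Qed.

Lemma cond_exp_mul2 (X Z V : T -> R) : is_cond_exp P <<s S >> X Z ->
  X \in Lfun P 2%:E -> V \in Lfun P 2%:E -> measurable_fun (setT : set TS) V ->
  ('E_P[(V \* Z)%R] = 'E_P[(V \* X)%R])%E.
Proof.
move=> XZ X2 V2 mV; have Z2 := cond_exp_Lfun2 XZ X2.
by apply: cond_exp_mul XZ _ _ _ _ => //; apply/Lfun1_integrable;
  [exact: Lfun21|exact: Lfun2_mul_Lfun1..].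
Qed.

Lemma cond_exp_expectation (X Z : T -> R) : is_cond_exp P <<s S >> X Z ->
  ('E_P[Z] = 'E_P[X])%E.
Proof.
case=> _ _ XZ; rewrite unlock; apply: XZ.
exact: (@measurableT _ (g_sigma_algebraType S)).
Qed.

End cond_exp_square.

(** * Independent families *)

Section cond_exp_pi_system.
Context d (T : measurableType d) (R : realType) (P : probability T R).

(** The sets over which [D] integrates to 0 form a Dynkin class; [G setT] is what allows
    complements. *)
Lemma integral_pi_system0 (G : set (set T)) (D : T -> R) :
  G `<=` measurable -> setI_closed G -> G setT ->
  P.-integrable setT (EFin \o D) ->
  (forall A, G A -> (\int[P]_(w in A) (D w)%:E = 0)%E) ->
  forall A, <<s G >> A -> (\int[P]_(w in A) (D w)%:E = 0)%E.
Proof.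
move=> Gm GI GT iD D0.
have sGm := gen_sub_measurable Gm.
apply: (@dynkin_induction _ (g_sigma_algebraType G) G) => //.
- exact: D0.
- move=> A SA DA0; have mA := sGm _ SA.
  have := D0 _ GT; rewrite -(setUv A) integral_setU//.
  + by rewrite DA0 add0e.
  + exact: measurableC.
  + by apply: measurable_funTS; exact: measurable_int iD.
  + exact/disj_setPCl.
- move=> F mF tF F0; rewrite integral_bigcup//.
  + by rewrite eseries0.
  + by move=> k; apply: sGm; exact: mF.
  + by apply: integrableS iD => //; apply: bigcup_measurable => k _; apply: sGm; exact: mF.
Qed.

Lemma cond_exp_pi_system (G : set (set T)) (X Z : T -> R) :
  G `<=` measurable -> setI_closed G -> G setT ->
  (forall B, measurable B -> <<s G >> (Z @^-1` B)) ->
  P.-integrable setT (EFin \o Z) -> P.-integrable setT (EFin \o X) ->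
  (forall A, G A -> (\int[P]_(w in A) (Z w)%:E = \int[P]_(w in A) (X w)%:E)%E) ->
  is_cond_exp P <<s G >> X Z.
Proof.
move=> Gm GI GT mZ iZ iX ZX; split=> // A SA.
have iD : P.-integrable setT (EFin \o (Z \- X)).
  by rewrite (_ : _ \o _ = (EFin \o Z) \- (EFin \o X))%E//; exact: integrableB.
have XA B : measurable B -> (\int[P]_(w in B) ((Z \- X) w)%:E =
    \int[P]_(w in B) (Z w)%:E - \int[P]_(w in B) (X w)%:E)%E.
  move=> mB; under eq_integral do rewrite EFinB.
  by rewrite integralB//=; [exact: integrableS iZ|exact: integrableS iX].
have Xfin B : measurable B -> (\int[P]_(w in B) (X w)%:E)%E \is a fin_num.
  by move=> mB; apply: integrable_fin_num => //; exact: integrableS iX.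
have mA := gen_sub_measurable Gm SA.
have D0 B : G B -> (\int[P]_(w in B) ((Z \- X) w)%:E = 0)%E.
  by move=> GB; rewrite XA ?ZX ?subee// ?Xfin//; exact: Gm.
have := integral_pi_system0 Gm GI GT iD D0 SA.
rewrite XA// => /eqP; rewrite sube_eq ?add0e ?Xfin//; first by move/eqP.
by apply: integrable_fin_num => //; exact: integrableS iZ.
Qed.

End cond_exp_pi_system.

(** * Cylinder sets and conditioning on independent coordinates *)

Section cylinders.
Context (T : pointedType) (R : realType) (I : choiceType) (W : I -> T -> R).

(** Unlike the preimages generating [sigma_gen D W], these finite intersections form a pi-system.
    [B] is a total family, of which only the values on [S] count. *)
Definition cylinder (D : set I) : set (set T) :=
  [set A | exists (S : {fset I}) (B : I -> set R),
    [/\ forall i, measurable (B i), forall i, i \in S -> D i &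
        A = \bigcap_(i in [set` S]) (W i @^-1` B i)]].

Lemma cylinderT D : cylinder D setT.
Proof.
exists fset0, (fun=> setT); split=> //.
by apply/seteqP; split=> w // _ i /=; rewrite inE.
Qed.

Lemma cylinder_setI D : setI_closed (cylinder D).
Proof.
move=> _ _ [S1 [B1 [mB1 SD1 ->]]] [S2 [B2 [mB2 SD2 ->]]].
exists (S1 `|` S2)%fset, (fun i => (if i \in S1 then B1 i else setT) `&`
  (if i \in S2 then B2 i else setT)); split.
- by move=> i; apply: measurableI; case: ifP.
- by move=> i; rewrite inE => /orP[/SD1|/SD2].
- apply/seteqP; split=> w /=.
    move=> [w1 w2] i _; split; case: ifPn => // iS; [exact: w1|exact: w2].
  move=> w12; split=> i /= iS.
    by have := w12 i; rewrite /= inE iS => /(_ isT)[].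
  by have := w12 i; rewrite /= inE iS orbT => /(_ isT)[].
Qed.

Lemma cylinderW D D' : D `<=` D' -> cylinder D `<=` cylinder D'.
Proof.
by move=> DD' _ [S [B [mB SD ->]]]; exists S, B; split=> // i /SD; exact: DD'.
Qed.

Lemma sigma_gen_cylinder D : sigma_gen D W = <<s cylinder D >>.
Proof.
apply/seteqP; split.
  apply: smallest_sub; first exact: smallest_sigma_algebra.
  move=> _ [i Di [B mB <-]]; apply: sub_sigma_algebra.
  exists [fset i]%fset, (fun=> B); split=> //.
    by move=> j; rewrite inE => /eqP ->.
  rewrite setTI; apply/seteqP; split=> w /=.
    by move=> Bw j /=; rewrite inE => /eqP ->.
  by move/(_ i); apply; rewrite /= inE.
apply: smallest_sub; first exact: smallest_sigma_algebra.
move=> _ [S [B [mB SD ->]]].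
rewrite bigcap_fset big_seq; apply: big_ind => //.
- exact: (@measurableT _ (g_sigma_algebraType _)).
- by move=> A A'; exact: (@measurableI _ (g_sigma_algebraType _)).
move=> i iS; apply: sub_sigma_algebra; exists i; first exact: SD.
by exists (B i) => //; rewrite setTI.
Qed.

Lemma sigma_genW D D' : D `<=` D' -> sigma_gen D W `<=` sigma_gen D' W.
Proof.
move=> DD'; rewrite !sigma_gen_cylinder.
by apply: sub_sigma_algebra2; exact: cylinderW.
Qed.

Lemma cylinder_split D E A : cylinder D A -> exists A1 A2,
  [/\ cylinder (D `&` E) A1, cylinder (D `\` E) A2 & A = A1 `&` A2].
Proof.
move=> [S [B [mB SD ->]]].
exists (\bigcap_(i in [set` [fset i in S | `[< E i >]]%fset]) (W i @^-1` B i)).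
exists (\bigcap_(i in [set` [fset i in S | ~~ `[< E i >]]%fset]) (W i @^-1` B i)).
split.
- exists [fset i in S | `[< E i >]]%fset, B; split=> // i.
  by rewrite !inE => /andP[/SD Di /asboolP].
- exists [fset i in S | ~~ `[< E i >]]%fset, B; split=> // i.
  by rewrite !inE => /andP[/SD Di /asboolPn].
- apply/seteqP; split=> w /=.
    by move=> wS; split=> i /=; rewrite !inE => /andP[iS _]; exact: wS.
  move=> [w1 w2] i /= iS; have [Ei|Ei] := boolP `[< E i >].
    by apply: w1; rewrite /= !inE iS Ei.
  by apply: w2; rewrite /= !inE iS Ei.
Qed.

End cylinders.

Section independent_cylinders.
Context d (T : measurableType d) (R : realType) (P : probability T R).
Variables (I : choiceType) (W : I -> T -> R).
Hypothesis mW : forall i, measurable_fun setT (W i).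

Lemma cylinder_measurable D : cylinder W D `<=` measurable.
Proof.
move=> _ [S [B [mB SD ->]]]; apply: fin_bigcap_measurable.
  exact: finite_fset.
by move=> i _; rewrite -[X in measurable X]setTI; exact: mW.
Qed.

Hypothesis indepW : mutually_independent P W.

Lemma cylinder_indep D1 D2 A1 A2 : D1 `&` D2 = set0 ->
  cylinder W D1 A1 -> cylinder W D2 A2 -> P (A1 `&` A2) = (P A1 * P A2)%E.
Proof.
move=> D12 [S1 [B1 [mB1 SD1 ->]]] [S2 [B2 [mB2 SD2 ->]]].
have S12 i : i \in S1 -> i \in S2 -> False.
  by move=> /SD1 D1i /SD2 D2i; suff : set0 i by []; rewrite -D12.
pose B i := if i \in S1 then B1 i else B2 i.
have mB i : measurable (B i) by rewrite /B; case: ifP.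
have -> : \bigcap_(i in [set` S1]) (W i @^-1` B1 i) `&`
    \bigcap_(i in [set` S2]) (W i @^-1` B2 i) =
    \bigcap_(i in [set` (S1 `|` S2)%fset]) (W i @^-1` B i).
  apply/seteqP; split=> w /=.
    move=> [w1 w2] i /=; rewrite inE /B; case: ifPn => [iS1 _|_ /= iS2].
      exact: w1.
    exact: w2.
  move=> w12; split=> i /= iS.
    by have := w12 i; rewrite /= inE /B iS; exact.
  have := w12 i; rewrite /= inE /B iS orbT => /(_ isT).
  by case: ifPn => // /S12/(_ iS).
rewrite !indepW//.
have /(perm_big _) -> : perm_eq (S1 `|` S2)%fset (S1 ++ S2).
  apply: uniq_perm => //; last by move=> i; rewrite mem_cat inE.
  rewrite cat_uniq !fset_uniq andbT/=; apply/hasPn => i iS2.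
  by apply/negP => /S12/(_ iS2).
rewrite big_cat/=; congr (_ * _)%E; apply: eq_big_seq => i iS; rewrite /B ?iS//.
by case: ifPn => // /S12/(_ iS).
Qed.

Lemma cond_exp_cylinder_indic D E A : D `&` E = set0 -> cylinder W D A ->
  is_cond_exp P (sigma_gen E W) \1_A (cst (fine (P A))).
Proof.
move=> DE cA; have mA := cylinder_measurable cA.
rewrite sigma_gen_cylinder; apply: cond_exp_pi_system.
- exact: cylinder_measurable.
- exact: cylinder_setI.
- exact: cylinderT.
- by move=> B mB; apply: (gen_measurable_funP (V := cst _)).
- exact: finite_measure_integrable_cst.
- exact: integrable_indic.
- move=> B cB; have mB := cylinder_measurable cB.
  transitivity ((fine (P A))%:E * P B)%E; first exact: (integral_cst P mB (fine (P A))%:E).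
  transitivity (P (A `&` B)); last by symmetry; exact: integral_indic.
  by rewrite (cylinder_indep DE cA cB) fineK// fin_num_measure.
Qed.

(** If [X] depends only on coordinates in [E], those in [F] outside [E] carry no information about
    it. A cylinder over [F] splits into [A1] over the common coordinates and [A2] over the others;
    [A2] contributes the factor [P A2] to the integrals of both [X] and [Z], which agree over [A1]
    by hypothesis. *)
Lemma cond_exp_setI F E (X Z : T -> R) :
  (forall B, measurable B -> sigma_gen E W (X @^-1` B)) ->
  P.-integrable setT (EFin \o X) ->
  is_cond_exp P (sigma_gen (F `&` E) W) X Z ->
  is_cond_exp P (sigma_gen F W) X Z.
Proof.
move=> mX iX [mZ iZ ZX].
have cm D' : cylinder W D' `<=` measurable := @cylinder_measurable D'.
rewrite sigma_gen_cylinder; apply: cond_exp_pi_system => //.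
- exact: cylinder_setI.
- exact: cylinderT.
- move=> B mB; rewrite -sigma_gen_cylinder.
  by apply: (sigma_genW (D := F `&` E)); [exact: subIsetl|exact: mZ].
move=> _ /(cylinder_split E)[A1 [A2 [cA1 cA2 ->]]].
have mA1 := cm _ _ cA1; have mA2 := cm _ _ cA2.
pose V f w : R := \1_A1 w * f w.
have mV f : (forall B, measurable B -> sigma_gen E W (f @^-1` B)) ->
    measurable_fun (setT : set (g_sigma_algebraType (cylinder W E))) (V f).
  move=> mf; apply: measurable_funM; last first.
    by apply: gen_measurable_fun; rewrite -sigma_gen_cylinder.
  apply: measurable_indic; apply: sub_sigma_algebra.
  by apply: cylinderW cA1; exact: subIsetr.
have iV (f : T -> R) : P.-integrable setT (EFin \o f) ->
    P.-integrable setT (EFin \o V f).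
  move=> iF; rewrite (_ : _ \o _ = (EFin \o f) \_ A1); last first.
    by apply/funext => w; rewrite epatch_indic /V muleC.
  by apply/(integrable_mkcond _ mA1); exact: integrableS iF.
(* [1_A2] is independent of [sigma_gen E W], so it factors out as [P A2] *)
have VA2 (f : T -> R) : (forall B, measurable B -> sigma_gen E W (f @^-1` B)) ->
    P.-integrable setT (EFin \o f) ->
    (\int[P]_(w in A1 `&` A2) (f w)%:E =
     P A2 * \int[P]_(w in A1) (f w)%:E)%E.
  move=> mf iF.
  have ED : (F `\` E) `&` E = set0 by rewrite setIC setDIK.
  have := cond_exp_cylinder_indic ED cA2; rewrite sigma_gen_cylinder => c2.
  have iVc : P.-integrable setT (EFin \o (V f \* cst (fine (P A2)))).
    exact: (integrableZr measurableT (fine (P A2)) (iV _ iF)).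
  have iV1 : P.-integrable setT (EFin \o (V f \* \1_A2)).
    rewrite (_ : _ \o _ = (EFin \o V f) \_ A2); last first.
      by apply/funext => w; rewrite epatch_indic.
    by apply/(integrable_mkcond _ mA2);
    exact: (integrableS measurableT mA2 (@subsetT _ _) (iV _ iF)).
  have := cond_exp_mul (cm E) c2 (integrable_indic P mA2) (mV f mf) iV1 iVc.
  rewrite !unlock => c3.
  rewrite integral_mkcond.
  transitivity (\int[P]_w ((V f \* \1_A2) w)%:E)%E.
    apply: eq_integral => w _; rewrite epatch_indic /V indicI /= !EFinM.
    by rewrite muleC muleAC.
  rewrite -c3.
  rewrite -[P A2]fineK ?fin_num_measure// [in RHS]integral_mkcond [RHS]muleC.
  have iA1 : P.-integrable setT ((EFin \o f) \_ A1).
    by apply/(integrable_mkcond _ mA1); exact: integrableS iF.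
  rewrite -(integralZr measurableT iA1).
  by apply: eq_integral => w _; rewrite epatch_indic /V /= !EFinM (muleC (f w)%:E).
rewrite !VA2//; last first.
  by move=> B mB; apply: (sigma_genW (D := F `&` E)); [exact: subIsetr|exact: mZ].
by rewrite ZX// sigma_gen_cylinder; exact: sub_sigma_algebra.
Qed.

End independent_cylinders.

(** * Joint laws of independent families *)

Section law.
Context d (T : measurableType d) (R : realType) (P : probability T R).
Variable I : choiceType.

Definition coord (i : I) (u : I -> R) : R := u i.

Lemma mutually_independent_inj (W : I -> T -> R) (s : I -> I) : injective s ->
  mutually_independent P W -> mutually_independent P (fun i => W (s i)).
Proof.
move=> sI indepW S B mB.
(* [s] need not be onto: indices outside its image receive the trivial constraint [setT]. *)
pose B' j := if pselect (exists i, s i = j) is left e then B (projT1 (cid e)) else setT.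
have B'E i : B' (s i) = B i.
  rewrite /B'; case: pselect => [e|[]]; last by exists i.
  by case: cid => j /= /sI ->.
have mB' j : measurable (B' j) by rewrite /B'; case: pselect.
have := indepW [fset s i | i in S]%fset B' mB'.
rewrite big_imfset/=; last by move=> i j _ _ /sI.
under [X in _ = X -> _]eq_bigr do rewrite B'E.
move=> <-; congr (P _); apply/seteqP; split=> w Sw i /=.
  by move=> /imfsetP[j /= jS ->]; rewrite B'E; exact: Sw.
by move=> iS; rewrite -B'E; apply: Sw => /=; exact: in_imfset.
Qed.

Lemma sigma_gen_coord (J : choiceType) (D : set I) (D' : set J) (V : I -> T -> R)
    (X : J -> T -> R) (A : set T) :
  (forall j, D' j -> exists2 i, D i & X j = V i) -> sigma_gen D' X A ->
  exists2 B, sigma_gen D coord B & A = [set w | B (V ^~ w)].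
Proof.
move=> XV XA.
have : preimage_set_system setT (fun w => V ^~ w) (sigma_gen D coord) A.
  apply: XA; split.
    apply: sigma_algebra_preimage; exact: smallest_sigma_algebra.
  move=> _ [j D'j [C mC <-]]; have [i Di ->] := XV j D'j.
  exists (coord i @^-1` C); last by [].
  by apply: sub_sigma_algebra; exists i => //; exists C => //; rewrite setTI.
by case=> B DB <-; exists B => //; rewrite setTI.
Qed.

Variables V1 V2 : I -> T -> R.
Hypothesis mV1 : forall i, measurable_fun setT (V1 i).
Hypothesis mV2 : forall i, measurable_fun setT (V2 i).
Hypothesis indepV1 : mutually_independent P V1.
Hypothesis indepV2 : mutually_independent P V2.
Hypothesis V12 : forall i (B : set R), measurable B ->
  P (V1 i @^-1` B) = P (V2 i @^-1` B).

Let U : measurableType _ := g_sigma_algebraType (cylinder (coord : I -> _ -> R) setT).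

Let measurable_family (V : I -> T -> R) :
  (forall i, measurable_fun setT (V i)) ->
  measurable_fun setT ((fun w => V ^~ w) : T -> U).
Proof.
move=> mV; apply: (@measurability _ _ T U setT (fun w => V ^~ w)
  (cylinder (coord : I -> _ -> R) setT)) => //.
move=> _ [_ [S [B [mB _ ->]]] <-].
rewrite setTI preimage_bigcap; apply: fin_bigcap_measurable.
  exact: finite_fset.
by move=> i _; rewrite -[X in measurable X]setTI; exact: mV.
Qed.

(** The push-forwards of [P] under both families agree on cylinders, hence on the product
    sigma-algebra. Treating positive and negative parts apart gives the equality without
    integrability of [F]. *)
Lemma same_law (F : (I -> R) -> R) :
  measurable_fun (setT : set U) F ->
  ('E_P[fun w => F (V1 ^~ w)] = 'E_P[fun w => F (V2 ^~ w)])%E.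
Proof.
move=> mF.
have mf1 := measurable_family mV1; have mf2 := measurable_family mV2.
pose mu1 := measure_function_pushforward__canonical__measure_function_Measure P mf1.
pose mu2 := measure_function_pushforward__canonical__measure_function_Measure P mf2.
have mu12 (B : set U) : measurable B -> mu1 B = mu2 B.
  apply: (@g_sigma_algebra_measure_unique _ R U (cylinder (coord : I -> _ -> R) setT)
    _ (fun=> setT) _ _ mu1 mu2).
  - exact: sub_sigma_algebra.
  - by move=> _; exact: cylinderT.
  - by rewrite bigcup_const.
  - exact: cylinder_setI.
  - move=> _ [S [B' [mB' _ ->]]]; rewrite /mu1 /mu2/= /pushforward.
    rewrite !preimage_bigcap indepV1// indepV2//.
    by apply: eq_bigr => i _; exact: V12.
  - by move=> _; rewrite /mu1/= /pushforward preimage_setT probability_setT ltry.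
have mu12_int (f : U -> \bar R) : measurable_fun setT f -> (forall u, 0 <= f u)%E ->
    (\int[P]_w f (V1 ^~ w) = \int[P]_w f (V2 ^~ w))%E.
  move=> mf f0.
  have := ge0_integral_pushforward mf1 P measurableT mf (fun u _ => f0 u).
  have := ge0_integral_pushforward mf2 P measurableT mf (fun u _ => f0 u).
  rewrite !preimage_setT /= => <- <-.
  by apply: eq_measure_integral => B mB _; exact: mu12.
have mFE : measurable_fun setT (EFin \o F : U -> _) by exact/measurable_EFinP.
have posE (V : I -> T -> R) : (fun w => (F (V ^~ w))%:E)^\+%E =
    fun w => (EFin \o F)^\+%E (V ^~ w).
  by apply/funext => w; rewrite !funeposE.
have negE (V : I -> T -> R) : (fun w => (F (V ^~ w))%:E)^\-%E =
    fun w => (EFin \o F)^\-%E (V ^~ w).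
  by apply/funext => w; rewrite !funenegE.
rewrite unlock integralE [RHS]integralE !posE !negE; congr (_ - _)%E.
  exact: (mu12_int _ (measurable_funepos mFE) (funepos_ge0 _)).
exact: (mu12_int _ (measurable_funeneg mFE) (funeneg_ge0 _)).
Qed.

End law.

(** * Kernels of the AHK variables *)

Lemma perm_upto n : perm_eq (upto n) (iota 0 n).
Proof.
by apply: uniq_perm; rewrite ?iota_uniq ?fset_uniq// => i; rewrite !inE.
Qed.

Lemma card_upto n : #|` upto n| = n.
Proof. by rewrite (perm_size (perm_upto n)) size_iota. Qed.

Section ext_inj.

(** A total injection, for duplicate-free [l], whose first values are the entries of [l]: past the
    end the values exceed [sumn l], which bounds each entry. It is not made onto, since injective
    reindexings already preserve independence and laws. *)
Definition ext_inj (l : seq nat) (i : nat) : nat :=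
  if (i < size l)%N then nth 0%N l i else ((i + sumn l).+1)%N.

Lemma leq_sumn (l : seq nat) i : i \in l -> (i <= sumn l)%N.
Proof.
elim: l => //= j l IH; rewrite inE => /predU1P[->|/IH il]; first exact: leq_addr.
exact: leq_trans il (leq_addl _ _).
Qed.

Lemma ext_inj_inj l : uniq l -> injective (ext_inj l).
Proof.
move=> ul i j; rewrite /ext_inj.
have lt k : (k < size l)%N -> (nth 0 l k <= sumn l)%N.
  by move=> kl; apply: leq_sumn; exact: mem_nth.
case: ifPn => il; case: ifPn => jl.
- by move/eqP; rewrite nth_uniq// => /eqP.
- by move=> e; have := lt _ il; rewrite e leqNgt ltnS leq_addl.
- by move=> e; have := lt _ jl; rewrite -e leqNgt ltnS leq_addl.
- by move=> [/eqP]; rewrite eqn_add2r => /eqP.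
Qed.

Lemma map_ext_inj l l' : map (ext_inj (l ++ l')) (iota 0 (size l)) = l.
Proof.
apply: (@eq_from_nth _ 0%N); rewrite size_map size_iota// => i il.
rewrite (nth_map 0%N) ?size_iota// nth_iota// add0n /ext_inj size_cat.
by rewrite (leq_trans il (leq_addr _ _)) nth_cat il.
Qed.

Lemma map_ext_inj_id l : map (ext_inj l) (iota 0 (size l)) = l.
Proof. by have := map_ext_inj l [::]; rewrite cats0. Qed.

Lemma map_ext_inj_mid l1 l2 l3 :
  map (ext_inj (l1 ++ l2 ++ l3)) (iota (size l1 + size l2) (size l3)) = l3.
Proof.
apply: (@eq_from_nth _ 0%N); rewrite size_map size_iota// => i il.
rewrite (nth_map 0%N) ?size_iota// nth_iota// /ext_inj !size_cat addnA.
rewrite ltn_add2l il catA nth_cat size_cat ltnNge leq_addr/=.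
by rewrite addnC addnK.
Qed.

End ext_inj.

Section kernel_seq.
Context (R : realType) (p q : nat) (h : 'M[R]_(p, q) -> R).
Hypothesis ker : kernel_function h.

(** Takes any real matrix and any lists, so that the kernel of [Y] and that of the AHK variables are
    both instances and enumerations can be changed. With lists of sizes [p] and [q] the default 0 is
    never read. *)
Definition kernel_seq (y : nat -> nat -> R) (l l' : seq nat) : R :=
  h (\matrix_(k < p, j < q) y (nth 0%N l k) (nth 0%N l' j)).

Let perm_nth m (l1 l2 : seq nat) : perm_eq l1 l2 -> size l2 = m ->
  exists s : 'S_m, forall i : 'I_m, nth 0%N l1 i = nth 0%N l2 (s i).
Proof.
move=> l12 sl2; have sl1 : size l1 = m by rewrite (perm_size l12).
pose t1 : m.-tuple nat := tcast sl1 (in_tuple l1).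
pose t2 : m.-tuple nat := tcast sl2 (in_tuple l2).
have e1 : t1 = l1 :> seq nat by rewrite val_tcast.
have e2 : t2 = l2 :> seq nat by rewrite val_tcast.
have /tuple_permP[s e] : perm_eq t1 t2 by rewrite e1 e2.
exists s => i; rewrite -e1 e -e2 -tnth_nth.
by rewrite -(tnth_nth 0%N (mktuple _)) tnth_mktuple.
Qed.

Lemma kernel_seq_perm y l1 l2 l1' l2' : perm_eq l1 l2 -> perm_eq l1' l2' ->
  size l2 = p -> size l2' = q -> kernel_seq y l1 l1' = kernel_seq y l2 l2'.
Proof.
move=> e e' s2 s2'; have [s hs] := perm_nth e s2; have [t ht] := perm_nth e' s2'.
rewrite /kernel_seq -[RHS](ker.2 s t); congr h.
by apply/matrixP => i j; rewrite !mxE hs ht.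
Qed.

Lemma kernel_seq_map y s t l l' : size l = p -> size l' = q ->
  kernel_seq (fun i j => y (s i) (t j)) l l' = kernel_seq y (map s l) (map t l').
Proof.
move=> sl sl'; rewrite /kernel_seq; congr h; apply/matrixP => i j; rewrite !mxE.
by rewrite (nth_map 0%N) ?sl// (nth_map 0%N) ?sl'.
Qed.

Lemma measurable_kernel_seq d (T : measurableType d) (y : T -> nat -> nat -> R) l l' :
  size l = p -> size l' = q ->
  (forall i j, i \in l -> j \in l' -> measurable_fun setT (fun w => y w i j)) ->
  measurable_fun setT (fun w => kernel_seq (y w) l l').
Proof.
move=> sl sl' my _ B mB; rewrite setTI.
pose M w : 'M[R]_(p, q) := \matrix_(k < p, j < q) y w (nth 0%N l k) (nth 0%N l' j).
(* Measurability of [h] refers to the sigma-algebra generated by the entries, so its preimages lie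
   in any sigma-algebra containing the generators, here that of the sets with measurable preimage
   under [M]. *)
have : [set C | measurable (M @^-1` C)] (h @^-1` B); last by [].
apply: ker.1 mB _ _; split.
  split => /=.
  - by rewrite preimage_set0.
  - by move=> A mA; rewrite setTD preimage_setC; exact: measurableC.
  - by move=> F mF; rewrite preimage_bigcup; exact: bigcupT_measurable.
move=> _ [[k j] _ [C mC <-]]; rewrite setTI/=.
have -> : M @^-1` ((fun N : 'M[R]_(p, q) => N k j) @^-1` C) =
    (fun w => y w (nth 0%N l k) (nth 0%N l' j)) @^-1` C.
  by apply/seteqP; split=> w /=; rewrite mxE.
rewrite -[X in measurable X]setTI; apply: my => //; apply: mem_nth.
  by rewrite sl.
by rewrite sl'.
Qed.

End kernel_seq.

Notation ahk_idx := (nat + nat + nat * nat)%type.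

Definition ahk_index (I J : {fset nat}) : set ahk_idx :=
  [set k | match k with
           | inl (inl i) => i \in I
           | inl (inr j) => j \in J
           | inr (i, j) => (i \in I) && (j \in J)
           end].

Definition ahk_reindex (s t : nat -> nat) (k : ahk_idx) : ahk_idx :=
  match k with
  | inl (inl i) => inl (inl (s i))
  | inl (inr j) => inl (inr (t j))
  | inr (i, j) => inr (s i, t j)
  end.

Lemma ahk_reindex_inj s t : injective s -> injective t ->
  injective (ahk_reindex s t).
Proof.
by move=> sI tI [[i|j]|[i j]] [[i'|j']|[i' j']] //= [];
  [move/sI ->|move/tI ->|move=> /sI -> /tI ->].
Qed.

(** Conditioning on the common variables of two index rectangles is thus again a projection of the
    same kind. *)
Lemma ahk_indexI I1 I2 J1 J2 : ahk_index I1 J1 `&` ahk_index I2 J2 =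
  ahk_index (I1 `&` I2)%fset (J1 `&` J2)%fset.
Proof.
apply/seteqP; split=> -[[i|j]|[i j]] /=; rewrite !inE.
- by move=> [-> ->].
- by move=> [-> ->].
- by move=> [/andP[-> ->] /andP[-> ->]].
- by move=> /andP[].
- by move=> /andP[].
- by move=> /andP[/andP[-> ->] /andP[-> ->]].
Qed.

Lemma ahk_indexS I1 I2 J1 J2 : (I1 `<=` I2)%fset -> (J1 `<=` J2)%fset ->
  ahk_index I1 J1 `<=` ahk_index I2 J2.
Proof.
move=> /fsubsetP sI /fsubsetP sJ [[i|j]|[i j]] /=; [exact: sI|exact: sJ|].
by move=> /andP[/sI -> /sJ ->].
Qed.

Section entry.
Context (R : realType) (phi : R * R * R -> R).

Definition ahk_entry (u : ahk_idx -> R) (i j : nat) : R :=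
  phi (u (inl (inl i)), u (inl (inr j)), u (inr (i, j))).

Lemma measurable_ahk_entry d (T : measurableType d) (V : ahk_idx -> T -> R)
    (I J : {fset nat}) i j : measurable_fun setT phi ->
  (forall k, ahk_index I J k -> measurable_fun setT (V k)) ->
  i \in I -> j \in J -> measurable_fun setT (fun w => ahk_entry (V ^~ w) i j).
Proof.
move=> mphi mV iI jJ; apply: measurableT_comp => //.
apply: measurable_fun_pair; first apply: measurable_fun_pair.
- exact: (mV (inl (inl i))).
- exact: (mV (inl (inr j))).
- by apply: (mV (inr (i, j))); rewrite /= iI.
Qed.

End entry.

Section ahk_kernel.
Context d (T : measurableType d) (R : realType) (P : probability T R).
Variables (Y : nat -> nat -> T -> R) (phi : R * R * R -> R).
Variables (xi eta : nat -> T -> R) (zeta : nat -> nat -> T -> R).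
Hypothesis mY : forall i j, measurable_fun setT (Y i j).
Hypothesis Yahk : AHK_representation P xi eta zeta Y phi.
Variables p q : nat.

Let W : ahk_idx -> T -> R := ahk_var xi eta zeta.

Let U : measurableType _ := g_sigma_algebraType (cylinder (@coord R ahk_idx) setT).

Let mphi : measurable_fun setT phi. Proof. by case: Yahk. Qed.
Let mW k : measurable_fun setT (W k). Proof. by case: Yahk. Qed.
Let indepW : mutually_independent P W. Proof. by case: Yahk. Qed.
Let W01 k : uniform01 P (W k). Proof. by case: Yahk. Qed.

(* Unlike [kernel_at h Y I J], to which it is only almost surely equal, this is
   [ahk_sigma I J]-measurable. *)
Definition ahk_kernel (h : 'M[R]_(p, q) -> R) (I J : {fset nat}) (w : T) : R :=
  kernel_seq h (ahk_entry phi (W ^~ w)) I J.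

Section kernel.
Variable h : 'M[R]_(p, q) -> R.
Hypothesis ker : kernel_function h.

Lemma sigma_gen_ahk_kernel (I J : {fset nat}) : #|` I| = p -> #|` J| = q ->
  forall B, measurable B -> ahk_sigma xi eta zeta I J (ahk_kernel h I J @^-1` B).
Proof.
move=> cI cJ B mB.
rewrite /ahk_sigma -/(ahk_index I J) sigma_gen_cylinder.
apply: gen_measurable_funP => //.
apply: measurable_kernel_seq => // i j iI jJ.
apply: measurable_ahk_entry iI jJ => // k kIJ.
apply: gen_measurable_fun => C mC; rewrite -sigma_gen_cylinder.
by apply: sub_sigma_algebra; exists k => //; exists C => //; rewrite setTI.
Qed.

Lemma measurable_ahk_kernel I J : #|` I| = p -> #|` J| = q ->
  measurable_fun setT (ahk_kernel h I J).
Proof.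
move=> cI cJ; apply: measurable_kernel_seq => // i j iI jJ.
exact: measurable_ahk_entry iI jJ.
Qed.

Lemma measurable_kernel_at I J : #|` I| = p -> #|` J| = q ->
  measurable_fun setT (kernel_at h Y I J).
Proof.
move=> cI cJ.
by apply: (@measurable_kernel_seq _ _ _ h ker _ _ (fun w i j => Y i j w) I J).
Qed.

(** A single null set serves all [I] and [J], since there are countably many entries. *)
Lemma kernel_at_ahk : {ae P, forall w, forall I J,
  kernel_at h Y I J w = ahk_kernel h I J w}.
Proof.
have : {ae P, forall w, forall i j, Y i j w = ahk_entry phi (W ^~ w) i j}.
  by apply: ae_foralln => i; apply: ae_foralln => j; case: Yahk.
apply: filterS => w Yw I J; rewrite /kernel_at /ahk_kernel /kernel_seq.
by congr h; apply/matrixP => i j; rewrite !mxE Yw.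
Qed.

Lemma measurable_coord_kernel_seq l l' : size l = p -> size l' = q ->
  measurable_fun (setT : set U) (fun u => kernel_seq h (ahk_entry phi u) l l').
Proof.
move=> sl sl'.
apply: (@measurable_kernel_seq _ _ _ h ker _ U (fun u => ahk_entry phi u)) => // i j _ _.
apply: (@measurable_ahk_entry _ _ _ U (@coord R ahk_idx) [fset i]%fset [fset j]%fset);
  rewrite ?inE//.
move=> k _; apply: gen_measurable_fun => C mC; rewrite -sigma_gen_cylinder.
by apply: sub_sigma_algebra; exists k => //; exists C => //; rewrite setTI.
Qed.

(** The index sets move into [s] and [t], leaving a fixed function of the reindexed AHK
    variables. *)
Lemma ahk_kernel_reindex s t l l' (I J : {fset nat}) w :
  size l = p -> size l' = q ->
  perm_eq (map s l) I -> perm_eq (map t l') J ->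
  ahk_kernel h I J w =
  kernel_seq h (ahk_entry phi (fun k => W (ahk_reindex s t k) w)) l l'.
Proof.
move=> sl sl' e e'; have sI : #|` I| = p by rewrite -(perm_size e) size_map.
have sJ : #|` J| = q by rewrite -(perm_size e') size_map.
by rewrite /ahk_kernel -(kernel_seq_perm ker _ e e')// -(kernel_seq_map h _ s t sl sl').
Qed.

End kernel.

Lemma expectation_reindex (F : (ahk_idx -> R) -> R) s t :
  injective s -> injective t ->
  measurable_fun (setT : set U) F ->
  ('E_P[(fun w => F (fun k => W (ahk_reindex s t k) w))] =
   'E_P[(fun w => F (W ^~ w))])%E.
Proof.
move=> sI tI mF; have sigI := ahk_reindex_inj sI tI.
apply: (@same_law _ _ _ P _ (fun k => W (ahk_reindex s t k)) W) => //.
- exact: mutually_independent_inj.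
- by move=> k B mB; rewrite !W01.
Qed.

(** The events that depend only on the coordinates in [D] form a sigma-algebra. The induction
    quantifies over both points, as complements exchange their roles. *)
Lemma coord_setP D B u u' : sigma_gen D (@coord R ahk_idx) B ->
  (forall k, D k -> u k = u' k) -> B u -> B u'.
Proof.
move=> DB uu' Bu.
suff : [set A : set (ahk_idx -> R) | forall v v', (forall k, D k -> v k = v' k) ->
    A v -> A v'] B by move/(_ u u' uu'); exact.
apply: DB; split.
  split => //=.
  - move=> A hA v v' vv' [_ nAv]; split=> // Av'; apply: nAv.
    by apply: hA Av' => k /vv'.
  - by move=> F hF v v' vv' [i _ Fv]; exists i => //; exact: hF vv' Fv.
move=> _ [k Dk [C mC <-]] v v' vv' [_ /= Cv]; split=> //=.
by rewrite /coord -vv'.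
Qed.

Section version.
Variable h : 'M[R]_(p, q) -> R.
Hypothesis ker : kernel_function h.
Hypothesis hL2 :
  ('E_P[(fun w => kernel_at h Y (upto p) (upto q) w ^+ 2)%R] < +oo)%E.

(** The moment hypothesis concerns the first [p] rows and [q] columns; reindexing moves it to any
    index sets of these sizes. *)
Lemma ahk_kernel_Lfun2 (I J : {fset nat}) : #|` I| = p -> #|` J| = q ->
  ahk_kernel h I J \in Lfun P 2%:E.
Proof.
move=> cI cJ; apply: Lfun_sqr_lty; first exact: measurable_ahk_kernel.
suff : forall I' J' : {fset nat}, #|` I'| = p -> #|` J'| = q ->
    ('E_P[(fun w => ahk_kernel h I' J' w ^+ 2)%R] =
     'E_P[(fun w => kernel_seq h (ahk_entry phi (W ^~ w)) (iota 0 p) (iota 0 q) ^+ 2)%R])%E.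
  move=> H; rewrite H// -(H _ _ (card_upto p) (card_upto q)).
  apply: le_lt_trans hL2; rewrite le_eqVlt; apply/orP; left; apply/eqP.
  rewrite unlock; apply: ae_eq_integral => //.
  - apply/measurable_EFinP; apply: measurable_funX.
    by apply: measurable_ahk_kernel => //; exact: card_upto.
  - apply/measurable_EFinP; apply: measurable_funX.
    by apply: measurable_kernel_at => //; exact: card_upto.
  - by apply: filterS (kernel_at_ahk h) => w Yw _; rewrite /= Yw.
move=> {cI cJ}I {}J cI cJ.
have sI := ext_inj_inj (fset_uniq I); have sJ := ext_inj_inj (fset_uniq J).
rewrite -(@expectation_reindex
  (fun u => kernel_seq h (ahk_entry phi u) (iota 0 p) (iota 0 q) ^+ 2) _ _ sI sJ).
  rewrite unlock; apply: eq_integral => w _; congr ((_ ^+ 2)%:E).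
  apply: ahk_kernel_reindex; rewrite ?size_iota//.
  + by rewrite -cI map_ext_inj_id.
  + by rewrite -cJ map_ext_inj_id.
by apply: measurable_funX; apply: measurable_coord_kernel_seq => //; exact: size_iota.
Qed.

Let perm_fsetD (I' I : {fset nat}) : (I' `<=` I)%fset ->
  perm_eq (enum_fset I' ++ enum_fset (I `\` I')%fset) I.
Proof.
move=> I'I; apply: uniq_perm => //.
  rewrite cat_uniq !fset_uniq andbT/=; apply/hasPn => i.
  by rewrite inE => /andP[].
move=> i; rewrite mem_cat inE; case: (boolP (i \in I')) => //= iI'.
by rewrite (fsubsetP I'I).
Qed.

Let perm_map_iota (I' I : {fset nat}) : (I' `<=` I)%fset ->
  perm_eq (map (ext_inj (enum_fset I' ++ enum_fset (I `\` I')%fset)) (iota 0 #|` I|)) I.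
Proof.
by move=> I'I; rewrite -(perm_size (perm_fsetD I'I)) map_ext_inj_id perm_fsetD.
Qed.

(** Enumerate [I] starting with [I'] in a fixed order, and likewise [J]. The reindexing then turns a
    fixed coordinate event into [A] and a fixed kernel into the one at [I] and [J], so the integral
    is an expectation free of [I] and [J]. *)
Lemma integral_ahk_kernel (I' J' : {fset nat}) A : ahk_sigma xi eta zeta I' J' A ->
  exists c : \bar R, forall I J : {fset nat},
    (I' `<=` I)%fset -> (J' `<=` J)%fset -> #|` I| = p -> #|` J| = q ->
    (\int[P]_(w in A) (ahk_kernel h I J w)%:E = c)%E.
Proof.
move=> sA.
pose V k := W (ahk_reindex (ext_inj I') (ext_inj J') k).
have [|B DB AB] := @sigma_gen_coord _ _ R _ _ (ahk_index (upto #|` I'|) (upto #|` J'|))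
    (ahk_index I' J') V W _ _ sA.
  have idx (K : {fset nat}) k : k \in K ->
      (index k K \in upto #|` K|) /\ ext_inj K (index k K) = k.
    move=> kK; rewrite (perm_mem (perm_upto _)) mem_iota /= add0n index_mem kK; split=> //.
    by rewrite /ext_inj index_mem kK nth_index.
  move=> [[i|j]|[i j]] /=.
  - move=> /idx[i1 i2]; exists (inl (inl (index i I'))) => //.
    by rewrite /V /= i2.
  - move=> /idx[i1 i2]; exists (inl (inr (index j J'))) => //.
    by rewrite /V /= i2.
  - move=> /andP[/idx[i1 i2] /idx[j1 j2]]; exists (inr (index i I', index j J')) => //=.
      by rewrite i1.
    by rewrite /V /= i2 j2.
exists ('E_P[(fun w => \1_B (W ^~ w) *
  kernel_seq h (ahk_entry phi (W ^~ w)) (iota 0 p) (iota 0 q))%R])%E => I J II JJ cI cJ.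
set s := ext_inj (enum_fset I' ++ enum_fset (I `\` I')%fset).
set t := ext_inj (enum_fset J' ++ enum_fset (J `\` J')%fset).
have sI : injective s.
  by apply: ext_inj_inj; rewrite (perm_uniq (perm_fsetD II)) fset_uniq.
have tI : injective t.
  by apply: ext_inj_inj; rewrite (perm_uniq (perm_fsetD JJ)) fset_uniq.
(* [B] sees only the coordinates that enumerate [I'] and [J'], where [s] and [t] agree with the
   injections used in [V]. *)
have AE w : A w <-> B (fun k => W (ahk_reindex s t k) w).
  have e : forall k, ahk_index (upto #|` I'|) (upto #|` J'|) k ->
      V k w = W (ahk_reindex s t k) w.
    have ee (l l' : seq nat) i : (i < size l)%N -> ext_inj l i = ext_inj (l ++ l') i.
      by move=> il; rewrite /ext_inj size_cat (leq_trans il (leq_addr _ _)) il nth_cat il.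
    have eu (K : {fset nat}) (l : seq nat) i : i \in upto #|` K| ->
        ext_inj K i = ext_inj (enum_fset K ++ l) i.
      rewrite (perm_mem (perm_upto _)) mem_iota /= add0n; exact: ee.
    move=> [[i|j]|[i j]] /=; rewrite /V /s /t /=.
    - by move=> /eu <-.
    - by move=> /eu <-.
    - by move=> /andP[/eu <- /eu <-].
  rewrite AB; split=> /=; first exact: coord_setP DB e.
  by apply: coord_setP DB _ => k /e.
rewrite -(@expectation_reindex (fun u => \1_B u *
  kernel_seq h (ahk_entry phi u) (iota 0 p) (iota 0 q)) _ _ sI tI); last first.
  apply: measurable_funM; last first.
    by apply: measurable_coord_kernel_seq => //; exact: size_iota.
  apply: measurable_indic; rewrite /measurable/= -sigma_gen_cylinder.
  exact: sigma_genW DB.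
rewrite integral_mkcond unlock; apply: eq_integral => w _.
rewrite epatch_indic -EFinM mulrC; congr (_ * _)%:E.
  by rewrite !indicE; congr ((nat_of_bool _)%:R); apply/idP/idP; rewrite !inE => /AE.
apply: ahk_kernel_reindex; rewrite ?size_iota// -?cI -?cJ; exact: perm_map_iota.
Qed.

End version.

End ahk_kernel.

(** The fresh elements are intervals starting at [M], above all of [I], and at [M + n]; their length
    is at most [n], so they do not overlap. *)
Lemma exists_supersets n (I : {fset nat}) : (#|` I| <= n)%N ->
  exists K K' : {fset nat}, [/\ #|` K| = n, #|` K'| = n & (K `&` K')%fset = I].
Proof.
move=> In; pose fresh a : {fset nat} := [fset i in iota a (n - #|` I|)]%fset.
have card_fresh a : #|` fresh a| = (n - #|` I|)%N.
  rewrite -[RHS](size_iota a); apply: perm_size.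
  by apply: uniq_perm; rewrite ?iota_uniq ?fset_uniq// => i; rewrite !inE.
have in_fresh a i : (i \in fresh a) = (a <= i < a + (n - #|` I|))%N.
  by rewrite !inE mem_iota.
pose M := (sumn I).+1.
have IM i : i \in I -> (i < M)%N by move=> iI; rewrite ltnS leq_sumn.
have card_sup a : (M <= a)%N -> #|` (I `|` fresh a)%fset| = n.
  move=> Ma; have := cardfsUI I (fresh a); rewrite (_ : (_ `&` _)%fset = fset0).
    by rewrite cardfs0 addn0 card_fresh => ->; rewrite subnKC.
  apply/fsetP => i; rewrite in_fsetI in_fresh in_fset0; apply/negP => /andP[/IM iM].
  by rewrite leqNgt (leq_trans iM Ma).
exists (I `|` fresh M)%fset, (I `|` fresh (M + n)%N)%fset.
rewrite !card_sup// ?leq_addr//; split=> //; apply/fsetP => i.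
rewrite in_fsetI !in_fsetU !in_fresh; case: (i \in I) => //=.
apply/negP => /andP[/andP[_ iM] /andP[Mi _]].
move: (leq_ltn_trans Mi iM); rewrite ltn_add2l ltnNge.
by rewrite leq_subr.
Qed.

(** * Versions of the projections and their covariances *)

Section psi_version.
Context d (T : measurableType d) (R : realType) (P : probability T R).
Variables (Y : nat -> nat -> T -> R) (phi : R * R * R -> R).
Variables (xi eta : nat -> T -> R) (zeta : nat -> nat -> T -> R).
Hypothesis mY : forall i j, measurable_fun setT (Y i j).
Hypothesis Yahk : AHK_representation P xi eta zeta Y phi.
Variables p q : nat.

Let W : ahk_idx -> T -> R := ahk_var xi eta zeta.

Let mW k : measurable_fun setT (W k). Proof. by case: Yahk. Qed.
Let indepW : mutually_independent P W. Proof. by case: Yahk. Qed.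

Let ahk_sigmaE I J : ahk_sigma xi eta zeta I J = <<s cylinder W (ahk_index I J) >>.
Proof. exact: sigma_gen_cylinder. Qed.

Let cylm D : cylinder W D `<=` measurable.
Proof. exact: cylinder_measurable. Qed.

(** Where [is_psi] provides some index sets, this demands all of them, and the kernel is that of the
    AHK variables. *)
Definition psi_version (h : 'M[R]_(p, q) -> R) (I J : {fset nat}) (Z : T -> R) :=
  forall K L : {fset nat}, (I `<=` K)%fset -> (J `<=` L)%fset ->
    #|` K| = p -> #|` L| = q ->
    is_cond_exp P (ahk_sigma xi eta zeta I J) (ahk_kernel phi xi eta zeta h K L) Z.

Section one_kernel.
Variable h : 'M[R]_(p, q) -> R.
Hypothesis ker : kernel_function h.
Hypothesis hL2 :
  ('E_P[(fun w => kernel_at h Y (upto p) (upto q) w ^+ 2)%R] < +oo)%E.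

Let X := ahk_kernel phi xi eta zeta h.

Let X2 (I J : {fset nat}) : #|` I| = p -> #|` J| = q -> X I J \in Lfun P 2%:E.
Proof. exact: (ahk_kernel_Lfun2 mY Yahk ker hL2). Qed.

Let X1 (I J : {fset nat}) : #|` I| = p -> #|` J| = q ->
  P.-integrable setT (EFin \o X I J).
Proof. by move=> cI cJ; apply/Lfun1_integrable/Lfun21; exact: X2. Qed.

(** A set of size [p] is its only superset of that size. Covariances of the summands of a
    U-statistic thereby become covariances of projections. *)
Lemma psi_version_ahk_kernel (I J : {fset nat}) : #|` I| = p -> #|` J| = q ->
  psi_version h I J (X I J).
Proof.
move=> cI cJ K L IK JL cK cL.
have -> : K = I by apply/esym/eqP; rewrite eqEfcard IK cI cK/=.
have -> : L = J by apply/esym/eqP; rewrite eqEfcard JL cJ cL/=.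
split=> //; last exact: X1.
exact: (sigma_gen_ahk_kernel Yahk ker).
Qed.

(** Changing the index sets is [integral_ahk_kernel]; passing from [Y] to the AHK variables costs a
    null set. *)
Lemma is_psi_version psi (I J : {fset nat}) : is_psi P xi eta zeta h Y psi ->
  (#|` I| <= p)%N -> (#|` J| <= q)%N -> psi_version h I J (psi I J).
Proof.
move=> psiP Ip Jq K L IK JL cK cL.
have [K0 [L0 [[IK0 cK0] [JL0 cL0] [mZ iZ ZX]]]] := psiP I J Ip Jq.
split=> // A sA; rewrite ZX//.
have mA : measurable A.
  by move: sA; rewrite ahk_sigmaE => /(gen_sub_measurable (@cylm _)).
have [c cE] := integral_ahk_kernel Yahk ker sA.
rewrite [RHS]cE// -(cE K0 L0)//; apply: ae_eq_integral => //.
- apply: measurable_funTS; apply/measurable_EFinP.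
  by apply: measurable_kernel_at.
- apply: measurable_funTS; apply/measurable_EFinP.
  exact: (measurable_ahk_kernel Yahk ker).
- by apply: filterS (kernel_at_ahk Yahk h) => w Yw _; rewrite /= Yw.
Qed.

Lemma psi_version_Lfun2 (I J : {fset nat}) Z : (#|` I| <= p)%N -> (#|` J| <= q)%N ->
  psi_version h I J Z -> Z \in Lfun P 2%:E.
Proof.
move=> /exists_supersets[K [K' [cK _ KI]]] /exists_supersets[L [L' [cL _ LJ]]].
move=> /(_ K L); rewrite -KI -LJ !fsubsetIl => /(_ isT isT cK cL).
rewrite ahk_sigmaE => /(cond_exp_Lfun2 (@cylm _)); apply; exact: X2.
Qed.

(** Tower property: supersets of [I1] and [J1] are also supersets of [I] and [J], so both variables
    are compared with one kernel. *)
Lemma psi_version_sub (I1 I J1 J : {fset nat}) Z C :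
  (#|` I1| <= p)%N -> (#|` J1| <= q)%N -> (I `<=` I1)%fset -> (J `<=` J1)%fset ->
  psi_version h I1 J1 Z -> psi_version h I J C ->
  is_cond_exp P (ahk_sigma xi eta zeta I J) Z C.
Proof.
move=> /exists_supersets[K [K' [cK _ KI]]] /exists_supersets[L [L' [cL _ LJ]]] II JJ.
have IK : (I1 `<=` K)%fset by rewrite -KI fsubsetIl.
have JL : (J1 `<=` L)%fset by rewrite -LJ fsubsetIl.
move=> /(_ K L IK JL cK cL)[_ _ ZX].
move=> /(_ K L (fsubset_trans II IK) (fsubset_trans JJ JL) cK cL)[mC iC CX].
split=> // A sA; rewrite CX// ZX//.
by apply: (sigma_genW (D := ahk_index I J)) => //; exact: ahk_indexS.
Qed.

Lemma psi_version_measurable (I J : {fset nat}) Z :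
  (#|` I| <= p)%N -> (#|` J| <= q)%N -> psi_version h I J Z ->
  forall B, measurable B -> ahk_sigma xi eta zeta I J (Z @^-1` B).
Proof.
move=> /exists_supersets[K [K' [cK _ KI]]] /exists_supersets[L [L' [cL _ LJ]]].
by move=> /(_ K L); rewrite -KI -LJ !fsubsetIl => /(_ isT isT cK cL)[].
Qed.

Lemma psi_version_expectation : exists c : R, forall (I J : {fset nat}) Z,
  (#|` I| <= p)%N -> (#|` J| <= q)%N -> psi_version h I J Z -> ('E_P[Z] = c%:E)%E.
Proof.
have sT : ahk_sigma xi eta zeta fset0 fset0 setT.
  by rewrite ahk_sigmaE; exact: (@measurableT _ (g_sigma_algebraType _)).
have [c cE] := integral_ahk_kernel Yahk ker sT.
exists (fine c) => I J Z /exists_supersets[K [K' [cK _ KI]]].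
move=> /exists_supersets[L [L' [cL _ LJ]]].
move=> /(_ K L); rewrite -KI -LJ !fsubsetIl => /(_ isT isT cK cL).
rewrite ahk_sigmaE => /cond_exp_expectation ->.
have XcE : ('E_P[X K L] = c)%E by rewrite unlock cE.
by rewrite -XcE fineK// expectation_fin_num//; apply: Lfun21; exact: X2.
Qed.

(** Only [set0] and [setT] are generated by no variables, so a version is constant everywhere, not
    merely almost surely. *)
Lemma psi_version_fset0 Z : psi_version h fset0 fset0 Z -> exists c, Z = cst c.
Proof.
move=> /psi_version_measurable; rewrite !cardfs0 => /(_ isT isT) mZ.
have triv A : ahk_sigma xi eta zeta fset0 fset0 A -> A = set0 \/ A = setT.
  rewrite ahk_sigmaE => sA.
  suff : [set B | B = set0 \/ B = setT] A by [].
  apply: sA; split.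
    split => /=.
    - by left.
    - by move=> B [->|->]; [right; rewrite setD0|left; rewrite setDv].
    - move=> F hF; have [[i Fi]|nF] := pselect (exists i, F i = setT).
        by right; apply/seteqP; split=> // w _; exists i => //; rewrite Fi.
      left; apply/seteqP; split=> // w [i _].
      by case: (hF i) => Fi; [rewrite Fi|case: nF; exists i].
  move=> _ [S [B [mB S0 ->]]]; right; apply/seteqP; split=> // w _ k /= /S0.
  by case: k => [[i|j]|[i j]] /=; rewrite ?inE.
exists (Z point); apply/funext => w.
have [Z0|ZT] := triv _ (mZ _ (measurable_set1 (Z point))).
  by suff : set0 (point : T) by []; rewrite -Z0.
by have : (Z @^-1` [set Z point]) w by rewrite ZT.
Qed.

End one_kernel.

Section two_kernels.
Variables h1 h2 : 'M[R]_(p, q) -> R.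
Hypothesis ker1 : kernel_function h1.
Hypothesis ker2 : kernel_function h2.
Hypothesis h1L2 :
  ('E_P[(fun w => kernel_at h1 Y (upto p) (upto q) w ^+ 2)%R] < +oo)%E.
Hypothesis h2L2 :
  ('E_P[(fun w => kernel_at h2 Y (upto p) (upto q) w ^+ 2)%R] < +oo)%E.

(* Both sides equal [E[Z1 C2]]: on the left because [C2 = E[Z2 | A_{I1,J1}]] by
   independence, on the right because [C1 = E[Z1 | A_{I1 & I2, J1 & J2}]]. *)
Lemma psi_version_mul (I1 I2 J1 J2 : {fset nat}) Z1 Z2 C1 C2 :
  (#|` I1| <= p)%N -> (#|` J1| <= q)%N -> (#|` I2| <= p)%N -> (#|` J2| <= q)%N ->
  psi_version h1 I1 J1 Z1 -> psi_version h2 I2 J2 Z2 ->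
  psi_version h1 (I1 `&` I2)%fset (J1 `&` J2)%fset C1 ->
  psi_version h2 (I1 `&` I2)%fset (J1 `&` J2)%fset C2 ->
  ('E_P[(Z1 \* Z2)%R] = 'E_P[(C1 \* C2)%R])%E.
Proof.
move=> I1p J1q I2p J2q v1 v2 w1 w2.
have Ip : (#|` (I1 `&` I2)%fset| <= p)%N.
  exact: leq_trans (fsubset_leq_card (fsubsetIl _ _)) I1p.
have Jq : (#|` (J1 `&` J2)%fset| <= q)%N.
  exact: leq_trans (fsubset_leq_card (fsubsetIl _ _)) J1q.
have Z1L := psi_version_Lfun2 ker1 h1L2 I1p J1q v1.
have Z2L := psi_version_Lfun2 ker2 h2L2 I2p J2q v2.
have C2L := psi_version_Lfun2 ker2 h2L2 Ip Jq w2.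
have mZ1 := psi_version_measurable I1p J1q v1.
have mZ2 := psi_version_measurable I2p J2q v2.
have mC2 := psi_version_measurable Ip Jq w2.
have c2 := psi_version_sub I2p J2q (fsubsetIr I1 I2) (fsubsetIr J1 J2) v2 w2.
have c1 := psi_version_sub I1p J1q (fsubsetIl I1 I2) (fsubsetIl J1 J2) v1 w1.
have c2' : is_cond_exp P (ahk_sigma xi eta zeta I1 J1) Z2 C2.
  apply: (@cond_exp_setI _ _ _ P _ W mW indepW (ahk_index I1 J1) (ahk_index I2 J2)) => //.
    by apply/Lfun1_integrable/Lfun21.
  by rewrite ahk_indexI.
move: c2' mZ1; rewrite ahk_sigmaE => c2' mZ1.
rewrite -(cond_exp_mul2 (@cylm _) c2' Z2L Z1L (gen_measurable_fun mZ1)).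
move: c1 mC2; rewrite ahk_sigmaE => c1 mC2.
have := cond_exp_mul2 (@cylm _) c1 Z1L C2L (gen_measurable_fun mC2).
have mulC (f g : T -> R) : (f \* g = g \* f) by apply/funext => w /=; rewrite mulrC.
by rewrite mulC (mulC C2 Z1).
Qed.

(** The row injection enumerates the common part of [K] and [K'], then the rest of [K], then the
    rest of [K']. So [K] becomes the first [p] indices and [K'] the first [a] followed by [p - a]
    indices from [p] on; columns are treated alike. The right-hand side knows the sets only through
    [a] and [b]. *)
Lemma expectation_ahk_kernelM (K L K' L' : {fset nat}) :
  #|` K| = p -> #|` L| = q -> #|` K'| = p -> #|` L'| = q ->
  let a := #|` (K `&` K')%fset| in let b := #|` (L `&` L')%fset| in
  ('E_P[(ahk_kernel phi xi eta zeta h1 K L \* ahk_kernel phi xi eta zeta h2 K' L')%R] =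
  'E_P[(fun w => kernel_seq h1 (ahk_entry phi (W ^~ w)) (iota 0 p) (iota 0 q) *
    kernel_seq h2 (ahk_entry phi (W ^~ w))
      (iota 0 a ++ iota p (p - a)) (iota 0 b ++ iota q (q - b)))%R])%E.
Proof.
move=> cK cL cK' cL' a b.
pose l (A B : {fset nat}) : seq nat := enum_fset (A `&` B)%fset ++
  enum_fset (A `\` B)%fset ++ enum_fset (B `\` A)%fset.
have ul A B : uniq (l A B).
  rewrite /l !cat_uniq !fset_uniq !andbT/= has_cat negb_or -andbA.
  by apply/and3P; split; apply/hasPn => i; rewrite !inE => /andP[/negbTE -> ->].
have card_split (A B : {fset nat}) n : #|` A| = n ->
    (#|` (A `&` B)%fset| + #|` (A `\` B)%fset|)%N = n.
  by move=> <-; rewrite (cardfsID B).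
have lA (A B : {fset nat}) n : #|` A| = n ->
    perm_eq (map (ext_inj (l A B)) (iota 0 n)) A.
  move=> cA; rewrite /l catA -(card_split A B n cA) -size_cat map_ext_inj.
  apply: uniq_perm; rewrite ?fset_uniq//.
    by have := ul A B; rewrite /l catA cat_uniq => /andP[].
  by move=> i; rewrite mem_cat !inE; case: (i \in A); case: (i \in B).
have lB (A B : {fset nat}) n : #|` A| = n -> #|` B| = n ->
    perm_eq (map (ext_inj (l A B)) (iota 0 #|` (A `&` B)%fset| ++
      iota n (n - #|` (A `&` B)%fset|))) B.
  move=> cA cB; rewrite map_cat {1}/l map_ext_inj.
  have -> : (n - #|` (A `&` B)%fset| = #|` (B `\` A)%fset|)%N.
    by rewrite -(card_split B A n cB) fsetIC addKn.
  rewrite -(card_split A B n cA) map_ext_inj_mid.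
  apply: uniq_perm; rewrite ?fset_uniq//.
    rewrite cat_uniq !fset_uniq andbT/=; apply/hasPn => i.
    by rewrite !inE => /andP[/negbTE ->].
  by move=> i; rewrite mem_cat !inE; case: (i \in A); case: (i \in B).
have size_mid (A B : {fset nat}) n : #|` A| = n ->
    size (iota 0 #|` (A `&` B)%fset| ++ iota n (n - #|` (A `&` B)%fset|)) = n.
  by move=> cA; rewrite size_cat !size_iota subnKC// -cA fsubset_leq_card// fsubsetIl.
rewrite -(@expectation_reindex _ _ _ P Y _ _ _ _ Yahk (fun u =>
   kernel_seq h1 (ahk_entry phi u) (iota 0 p) (iota 0 q) *
   kernel_seq h2 (ahk_entry phi u)
      (iota 0 a ++ iota p (p - a)) (iota 0 b ++ iota q (q - b)))
  (ext_inj (l K K')) (ext_inj (l L L'))).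
- rewrite unlock; apply: eq_integral => w _; congr (_%:E); rewrite /=; congr (_ * _).
    by apply: ahk_kernel_reindex => //; rewrite ?size_iota//; exact: lA.
  by apply: ahk_kernel_reindex => //; [exact: size_mid..|exact: lB|exact: lB].
- exact: ext_inj_inj.
- exact: ext_inj_inj.
- apply: measurable_funM; apply: (measurable_coord_kernel_seq Yahk) => //.
  + exact: size_iota.
  + exact: size_iota.
  + exact: size_mid.
  + exact: size_mid.
Qed.

Lemma covariance_psi_version psi1 psi2 :
  is_psi P xi eta zeta h1 Y psi1 -> is_psi P xi eta zeta h2 Y psi2 ->
  exists G : nat -> nat -> R, G 0%N 0%N = 0 /\
    forall (I1 I2 J1 J2 : {fset nat}) Z1 Z2,
      (#|` I1| <= p)%N -> (#|` J1| <= q)%N -> (#|` I2| <= p)%N -> (#|` J2| <= q)%N ->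
      psi_version h1 I1 J1 Z1 -> psi_version h2 I2 J2 Z2 ->
      covariance P Z1 Z2 =
      (G #|` (I1 `&` I2)%fset| #|` (J1 `&` J2)%fset|)%:E.
Proof.
move=> psi1P psi2P.
have [c1 c1E] := psi_version_expectation ker1 h1L2.
have [c2 c2E] := psi_version_expectation ker2 h2L2.
pose M a b := ('E_P[(fun w => kernel_seq h1 (ahk_entry phi (W ^~ w)) (iota 0 p) (iota 0 q) *
    kernel_seq h2 (ahk_entry phi (W ^~ w))
      (iota 0 a ++ iota p (p - a)) (iota 0 b ++ iota q (q - b)))%R])%E.
pose G a b := fine (M a b) - c1 * c2.
have covE (I1 I2 J1 J2 : {fset nat}) Z1 Z2 :
    (#|` I1| <= p)%N -> (#|` J1| <= q)%N -> (#|` I2| <= p)%N -> (#|` J2| <= q)%N ->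
    psi_version h1 I1 J1 Z1 -> psi_version h2 I2 J2 Z2 ->
    covariance P Z1 Z2 = (G #|` (I1 `&` I2)%fset| #|` (J1 `&` J2)%fset|)%:E.
  move=> I1p J1q I2p J2q v1 v2.
  have Z1L := psi_version_Lfun2 ker1 h1L2 I1p J1q v1.
  have Z2L := psi_version_Lfun2 ker2 h2L2 I2p J2q v2.
  have Z12 := Lfun2_mul_Lfun1 Z1L Z2L.
  rewrite covarianceE; [|exact: Lfun21|exact: Lfun21|exact: Z12].
  rewrite (c1E _ _ _ I1p J1q v1) (c2E _ _ _ I2p J2q v2) -EFinM.
  rewrite /G; suff <- : 'E_P[Z1 * Z2]%E = M #|` (I1 `&` I2)%fset| #|` (J1 `&` J2)%fset|.
    by rewrite -[X in (X - _)%E]fineK ?EFinB// expectation_fin_num.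
  have Ip : (#|` (I1 `&` I2)%fset| <= p)%N.
    exact: leq_trans (fsubset_leq_card (fsubsetIl _ _)) I1p.
  have Jq : (#|` (J1 `&` J2)%fset| <= q)%N.
    exact: leq_trans (fsubset_leq_card (fsubsetIl _ _)) J1q.
  have w1 := is_psi_version ker1 psi1P Ip Jq.
  have w2 := is_psi_version ker2 psi2P Ip Jq.
  rewrite [LHS](psi_version_mul I1p J1q I2p J2q v1 v2 w1 w2).
  (* [K] and [K'] meet exactly in the common rows, [L] and [L'] in the common columns, so
     [psi_version_mul] applies once more, backwards, to two full-size kernels. *)
  have [K [K' [cK cK' KI]]] := exists_supersets Ip.
  have [L [L' [cL cL' LJ]]] := exists_supersets Jq.
  have x1 := psi_version_ahk_kernel ker1 h1L2 cK cL.
  have x2 := psi_version_ahk_kernel ker2 h2L2 cK' cL'.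
  rewrite -KI -LJ in w1 w2 *.
  rewrite -[LHS](psi_version_mul _ _ _ _ x1 x2 w1 w2) ?cK ?cL ?cK' ?cL'//.
  exact: expectation_ahk_kernelM.
exists G; split=> //.
(* At empty index sets the projection is constant, so the covariance [G 0 0] is 0. *)
have v1 := @is_psi_version _ ker1 _ fset0 fset0 psi1P.
have v2 := @is_psi_version _ ker2 _ fset0 fset0 psi2P.
rewrite !cardfs0 in v1 v2; have {}v1 := v1 isT isT; have {}v2 := v2 isT isT.
have := covE _ _ _ _ _ _ _ _ _ _ v1 v2; rewrite fsetIid !cardfs0.
have [c ->] := psi_version_fset0 v1.
by rewrite covariance_cst_l => /(_ isT isT isT isT)[].
Qed.

End two_kernels.
End psi_version.

(** * Counting and Moebius inversion *)

Section ksubsets.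

Lemma in_ksubsets k (A I : {fset nat}) :
  (I \in ksubsets k A) = (I `<=` A)%fset && (#|` I| == k).
Proof. by rewrite !inE fpowersetE. Qed.

Lemma card_ksubsets k A : #|` ksubsets k A| = 'C(#|` A|, k).
Proof.
have cardY (Y : {set A}) : #|` [fsetval y in Y]%fset| = #|Y|.
  by rewrite card_imfset; [rewrite -cardE|exact: val_inj].
have -> : ksubsets k A =
    [fset [fsetval y in Y : {set A}]%fset | Y in finset (fun Y : {set A} => #|Y| == k)]%fset.
  apply/fsetP => I; rewrite in_ksubsets -fpowersetE.
  apply/andP/imfsetP => /= [[/imfsetP[/= Y _ ->] Yk]|[Y]].
    by exists Y => //; rewrite inE -cardY.
  rewrite inE => Yk ->; rewrite cardY; split=> //.
  by apply/imfsetP; exists Y => //=; rewrite powersetT inE.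
rewrite card_imfset/=; first by rewrite -cardE card_draws cardfE.
by move=> X Y /fsetP eqXY; apply/setP => x; have := eqXY (val x); rewrite !inE.
Qed.

Lemma ksubsets_full (A : {fset nat}) : ksubsets #|` A| A = [fset A]%fset.
Proof.
apply/fsetP => I; rewrite in_ksubsets inE.
apply/andP/eqP => [[IA /eqP cI]|->]; last by rewrite fsubset_refl.
by apply/eqP; rewrite eqEfcard IA cI/=.
Qed.

Lemma card_ksubsets_sup k (A K : {fset nat}) : (K `<=` A)%fset -> (#|` K| <= k)%N ->
  #|` [fset I in ksubsets k A | (K `<=` I)%fset]%fset| =
  'C(#|` A| - #|` K|, k - #|` K|).
Proof.
move=> KA Kk; rewrite -cardfsDS// -card_ksubsets.
have -> : [fset I in ksubsets k A | (K `<=` I)%fset]%fset =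
    [fset (K `|` J)%fset | J in ksubsets (k - #|` K|) (A `\` K)]%fset.
  apply/fsetP => I; rewrite in_fset inE /= in_ksubsets.
  apply/andP/imfsetP => /= [[/andP[IA /eqP cI] KI]|[J]].
    exists (I `\` K)%fset; last by rewrite fsetUDl fsetDv fsetD0 fsetUC; apply/esym/fsetUidPl.
    by rewrite in_ksubsets fsetSD//= cardfsDS// cI.
  rewrite in_ksubsets fsubsetD => /andP[/andP[JA JK] /eqP cJ] ->.
  rewrite fsubUset KA JA fsubsetUl; split=> //=.
  have := cardfsUI K J; rewrite fsetIC (disjoint_fsetI0 JK) cardfs0 addn0 => ->.
  by rewrite cJ subnKC.
rewrite card_in_imfset//= => J J'; rewrite !in_ksubsets !fsubsetD.
move=> /andP[/andP[_ JK] _] /andP[/andP[_ J'K] _] /fsetP JJ'.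
apply/fsetP => i; have := JJ' i; rewrite !in_fsetU.
case: (boolP (i \in K)) => //= iK _.
have /negbTE -> : i \notin J by apply: contraL iK => iJ; exact: (fdisjointP JK).
by have /negbTE -> : i \notin J' by apply: contraL iK => iJ; exact: (fdisjointP J'K).
Qed.

(** Any bound [n] on the size is allowed, so that sums over different sets can share one range. *)
Lemma sum_fpowerset (V : nmodType) (F : {fset nat} -> V) (A : {fset nat}) n :
  (#|` A| <= n)%N ->
  \sum_(I <- fpowerset A) F I = \sum_(k < n.+1) \sum_(I <- ksubsets k A) F I.
Proof.
move=> An; rewrite big_seq (partition_big (fun I => inord #|` I| : 'I_n.+1) xpredT)//=.
apply: eq_bigr => k _; rewrite /ksubsets big_fset/= [RHS]big_seq_cond.
apply: eq_bigl => I; case: (boolP (I \in _)) => //=; rewrite fpowersetE => IA.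
have In : (#|` I| < n.+1)%N by rewrite ltnS (leq_trans (fsubset_leq_card IA)).
by rewrite -(inj_eq val_inj)/= inordK.
Qed.

(** Double counting: the binomial counts the sets [K] of size [r] contained in both [I] and [I'],
    and each [K] leaves ['C(m - r, p - r)] choices for [I] and as many for [I']. *)
Lemma sum_bin_fsetI m p r : (r <= p)%N -> (p <= m)%N ->
  (\sum_(I <- ksubsets p (upto m)) \sum_(I' <- ksubsets p (upto m))
    'C(#|` (I `&` I')%fset|, r) = 'C(m, r) * 'C(m - r, p - r) ^ 2)%N.
Proof.
move=> rp pm.
have binE (I I' : {fset nat}) : I \in ksubsets p (upto m) ->
    'C(#|` (I `&` I')%fset|, r) =
    (\sum_(K <- ksubsets r (upto m)) (K `<=` I)%fset * (K `<=` I')%fset)%N.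
  rewrite in_ksubsets => /andP[Im _].
  rewrite -card_ksubsets (eq_bigr (fun K : {fset nat} => (K `<=` I `&` I')%fset : nat)).
    rewrite -big_mkcond sum1_count -size_filter; apply: perm_size.
    apply: uniq_perm; rewrite ?filter_uniq ?fset_uniq// => K.
    rewrite mem_filter !in_ksubsets; case: (boolP (fsubset _ _)) => //= KI.
    by rewrite (fsubset_trans KI)// (fsubset_trans (fsubsetIl _ _)).
  by move=> K _; rewrite fsubsetI; case: fsubset; case: fsubset.
have supE K : K \in ksubsets r (upto m) ->
    (\sum_(I <- ksubsets p (upto m)) (K `<=` I)%fset = 'C(m - r, p - r))%N.
  rewrite in_ksubsets => /andP[Km /eqP cK].
  have := card_ksubsets_sup Km; rewrite cK card_upto => /(_ p rp) <-.
  rewrite -big_mkcond sum1_count -size_filter; apply: perm_size.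
  by apply: uniq_perm; rewrite ?filter_uniq ?fset_uniq// => I; rewrite mem_filter !inE andbC.
transitivity (\sum_(K <- ksubsets r (upto m)) \sum_(I <- ksubsets p (upto m))
    \sum_(I' <- ksubsets p (upto m)) (K `<=` I)%fset * (K `<=` I')%fset)%N.
  rewrite [RHS]exchange_big/=; apply: eq_big_seq => I IS; rewrite [RHS]exchange_big/=.
  by apply: eq_bigr => I' _; rewrite binE.
rewrite (eq_big_seq (fun=> 'C(m - r, p - r) ^ 2)%N) /=; last first.
  by move=> K KS; rewrite -big_distrlr/= supE// mulnn.
by rewrite big_const_seq count_predT iter_addn_0 card_ksubsets card_upto mulnC.
Qed.

End ksubsets.

(** * Moebius inversion for down-sets with meets *)

Section moebius_orthogonality.
Context (R : zmodType) (Q : eqType).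
Variables (dn : Q -> seq Q) (meet : Q -> Q -> Q) (rk : Q -> nat) (adm : pred Q).
Hypothesis dn_uniq : forall x, uniq (dn x).
Hypothesis dn_refl : forall x, x \in dn x.
Hypothesis dn_meet : forall a c x, (x \in dn (meet a c)) = (x \in dn a) && (x \in dn c).
Hypothesis meetxx : forall x, meet x x = x.
Hypothesis dn_rk : forall x y, y \in dn x -> (y == x) || (rk y < rk x)%N.
Hypothesis dn_adm : forall x y, y \in dn x -> adm x -> adm y.
Variables (b : Q -> Q -> R) (g : Q -> R).
Hypothesis bE : forall a c, adm a -> adm c ->
  \sum_(x <- dn a) \sum_(y <- dn c) b x y = g (meet a c).

Let sum_diag (s t u : seq Q) (f : Q -> R) : uniq s -> uniq t -> uniq u ->
  (forall x, (x \in u) = (x \in s) && (x \in t)) ->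
  \sum_(x <- s) \sum_(y <- t) (if x == y then f x else 0) = \sum_(x <- u) f x.
Proof.
move=> us ut uu ust.
transitivity (\sum_(x <- s) (if x \in t then f x else 0)).
  apply: eq_bigr => x _; rewrite -big_mkcond -big_filter.
  case: (boolP (x \in t)) => xt.
    rewrite (_ : [seq i <- t | x == i] = [:: x]) ?big_seq1//.
    rewrite (eq_filter (a2 := pred1 x)); last by move=> y; rewrite /= eq_sym.
    exact: filter_pred1_uniq.
  rewrite big_filter big_seq_cond big1// => y /andP[yt /eqP xy].
  by rewrite xy yt in xt.
rewrite -big_mkcond -big_filter; apply: perm_big; apply: uniq_perm => //.
  exact: filter_uniq.
by move=> x; rewrite mem_filter ust andbC.
Qed.

Let dn_rk_le x y : y \in dn x -> (rk y <= rk x)%N.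
Proof. by move/dn_rk => /predU1P[->|/ltnW]. Qed.

(** Induction on the sum of the ranks. The double sum below [a] and [c] and the diagonal sum below
    their meet both equal [g (meet a c)]. By induction they match term by term except at [(a, c)],
    which is off the diagonal, so [b a c] must vanish. *)
Lemma moebius_orth a c : adm a -> adm c -> a != c -> b a c = 0.
Proof.
have [n] := ubnP (rk a + rk c); elim: n a c => // n IH a c.
rewrite ltnS => acn aa ac ac'.
have md x : x \in dn (meet a c) -> (x \in dn a) * (x \in dn c).
  by rewrite dn_meet => /andP[-> ->].
have [ma mc] := md _ (dn_refl _).
(* As [a] and [c] differ, their meet lies strictly below one of them. *)
have mac : (rk (meet a c) + rk (meet a c) < rk a + rk c)%N.
  have := dn_rk ma; have := dn_rk mc; case/predU1P => [mc'|mc'].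
    by case/predU1P => [ma'|ma']; [rewrite -ma' mc' eqxx in ac'|rewrite mc' ltn_add2r -mc'].
  by move=> _; rewrite -addnS leq_add// dn_rk_le.
have am := dn_adm ma aa.
have e1 : \sum_(x <- dn (meet a c)) b x x = g (meet a c).
  rewrite -[in RHS](meetxx (meet a c)) -bE//.
  rewrite -(@sum_diag (dn (meet a c)) (dn (meet a c)))//; last by move=> x; rewrite andbb.
  apply: eq_big_seq => x xm; apply: eq_big_seq => y ym.
  case: eqVneq => [->//|xy]; symmetry; apply: IH => //.
  - by apply: leq_trans acn; apply: leq_ltn_trans mac; rewrite leq_add// dn_rk_le.
  - exact: dn_adm xm am.
  - exact: dn_adm ym am.
have e2 : \sum_(x <- dn a) \sum_(y <- dn c) (if x == y then b x x else 0) = g (meet a c).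
  by rewrite (@sum_diag _ _ (dn (meet a c))).
have := bE aa ac; rewrite -e2.
rewrite (big_rem a)//= (big_rem a (dn_refl a))/= .
rewrite (big_rem c)//= [X in _ = X + _ -> _](big_rem c)//= (negbTE ac') add0r.
set A := \sum_(y <- rem c (dn c)) _; set B := \sum_(x <- rem a _) _.
set A' := \sum_(y <- rem c (dn c)) _; set B' := \sum_(x <- rem a _) _.
have -> : A = A'.
  apply: eq_big_seq => y; rewrite mem_rem_uniq// inE => /andP[yc yd].
  case: eqVneq => [<-//|ay]; apply: IH => //; last exact: dn_adm yd ac.
  apply: leq_trans acn; rewrite ltn_add2l.
  by have := dn_rk yd; rewrite (negbTE yc).
have -> : B = B'.
  apply: eq_big_seq => x; rewrite mem_rem_uniq// inE => /andP[xa xd].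
  apply: eq_big_seq => y yd.
  case: eqVneq => [<-//|xy]; apply: IH => //; [|exact: dn_adm xd aa|exact: dn_adm yd ac].
  apply: leq_trans acn; apply: (@leq_trans (rk x + rk c).+1).
    by rewrite ltnS leq_add2l dn_rk_le.
  by rewrite ltn_add2r; have := dn_rk xd; rewrite (negbTE xa).
by rewrite -addrA => /(canRL (addrK _)); rewrite subrr.
Qed.

Lemma moebius_diag a : adm a -> \sum_(x <- dn a) b x x = g a.
Proof.
move=> aa; rewrite -[in RHS](meetxx a) -bE//.
rewrite -(@sum_diag (dn a) (dn a))//; last by move=> x; rewrite andbb.
apply: eq_big_seq => x xa; apply: eq_big_seq => y ya.
case: eqVneq => [->//|xy]; symmetry; apply: moebius_orth => //.
  exact: dn_adm xa aa.
exact: dn_adm ya aa.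
Qed.

End moebius_orthogonality.

Section fset_pairs.
Implicit Types x y : {fset nat} * {fset nat}.

Definition pair_powerset x : seq ({fset nat} * {fset nat}) :=
  [seq (A, B) | A <- fpowerset x.1, B <- fpowerset x.2].

Lemma mem_pair_powerset x y :
  (y \in pair_powerset x) = (y.1 `<=` x.1)%fset && (y.2 `<=` x.2)%fset.
Proof.
rewrite -!fpowersetE; apply/allpairsP/andP => [[[I J] [/= II JJ ->]]//|[II JJ]].
by exists y; split=> //; case: y {II JJ}.
Qed.

Lemma pair_powerset_uniq x : uniq (pair_powerset x).
Proof. by apply: allpairs_uniq => // -[I J] [I' J'] _ _ /= [-> ->]. Qed.

Lemma pair_powerset_card x y : y \in pair_powerset x ->
  (y == x) || (#|` y.1| + #|` y.2| < #|` x.1| + #|` x.2|)%N.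
Proof.
case: x y => [I J] [I' J']; rewrite mem_pair_powerset /= => /andP[II JJ].
rewrite xpair_eqE !eqEfcard II JJ/=.
have aux (a b c k : nat) : (a <= c)%N -> (b <= k)%N ->
  (c <= a)%N && (k <= b)%N || (a + b < c + k)%N by lia.
exact: aux (fsubset_leq_card II) (fsubset_leq_card JJ).
Qed.

Lemma big_pair_powerset (V : nmodType) x (F : {fset nat} * {fset nat} -> V) :
  \sum_(y <- pair_powerset x) F y =
  \sum_(A <- fpowerset x.1) \sum_(B <- fpowerset x.2) F (A, B).
Proof. exact: big_allpairs. Qed.

End fset_pairs.

Section size_moebius.
Context (R : zmodType) (p q : nat).
Variables (e : {fset nat} -> {fset nat} -> R) (G : nat -> nat -> R).
Hypothesis eG : forall I J : {fset nat}, (#|` I| <= p)%N -> (#|` J| <= q)%N ->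
  \sum_(I' <- fpowerset I) \sum_(J' <- fpowerset J) e I' J' = G #|` I| #|` J|.

Let f r c := e (upto r) (upto c).

Let sum_card n (V : zmodType) (F : nat -> V) (A : {fset nat}) : (#|` A| <= n)%N ->
  \sum_(I <- fpowerset A) F #|` I| = \sum_(k < n.+1) F k *+ 'C(#|` A|, k).
Proof.
move=> An; rewrite (sum_fpowerset _ An); apply: eq_bigr => k _.
rewrite (eq_big_seq (fun=> F k)) /=; last by move=> I; rewrite in_ksubsets => /andP[_ /eqP ->].
by rewrite big_const_seq count_predT iter_addr_0 card_ksubsets.
Qed.

Let sum_card2 (A B : {fset nat}) : (#|` A| <= p)%N -> (#|` B| <= q)%N ->
  \sum_(I <- fpowerset A) \sum_(J <- fpowerset B) f #|` I| #|` J| =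
  \sum_(r < p.+1) \sum_(c < q.+1) f r c *+ ('C(#|` A|, r) * 'C(#|` B|, c)).
Proof.
move=> Ap Bq.
rewrite (@sum_card p _ (fun r => \sum_(J <- fpowerset B) f r #|` J|))//.
apply: eq_bigr => r _; rewrite (sum_card _ Bq) -sumrMnl; apply: eq_bigr => c _.
by rewrite -mulrnA mulnC.
Qed.

(** Induction on the total size: proper pairs of subsets contribute by their sizes only, and [G]
    fixes the full sum, so the top term depends on the sizes as well. *)
Lemma size_moebius_card (I J : {fset nat}) : (#|` I| <= p)%N -> (#|` J| <= q)%N ->
  e I J = f #|` I| #|` J|.
Proof.
have [n] := ubnP (#|` I| + #|` J|); elim: n I J => // n IH I J; rewrite ltnS => IJn Ip Jq.
(* The subtracted sum is the sum over subsets of [A] and [B] with [f] in place of [e], so only the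
   top terms remain. The resulting value is the same for [(I, J)] and for the initial segments of
   these sizes. *)
have split_top (A B : {fset nat}) : #|` A| = #|` I| -> #|` B| = #|` J| ->
    e A B = f #|` I| #|` J| + (G #|` I| #|` J| -
      \sum_(r < p.+1) \sum_(c < q.+1) f r c *+ ('C(#|` I|, r) * 'C(#|` J|, c))).
  move=> cA cB; have Ap : (#|` A| <= p)%N by rewrite cA.
  have Bq : (#|` B| <= q)%N by rewrite cB.
  rewrite -cA -cB -eG// -sum_card2//.
  rewrite -(big_pair_powerset (A, B) (fun y => e y.1 y.2)).
  rewrite -(big_pair_powerset (A, B) (fun y => f #|` y.1| #|` y.2|)).
  have AB : (A, B) \in pair_powerset (A, B) by rewrite mem_pair_powerset !fsubset_refl.
  rewrite !(big_rem (A, B) AB)/=.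
  rewrite [X in _ + (_ + X - _)](eq_big_seq
    (fun y : {fset nat} * {fset nat} => f #|` y.1| #|` y.2|)).
    by rewrite opprD addrACA subrr addr0 addrCA subrr addr0.
  move=> [I' J']; rewrite mem_rem_uniq ?pair_powerset_uniq// inE => /andP[ne IJ'].
  have := pair_powerset_card IJ'; rewrite (negbTE ne)/= => lt.
  move: IJ'; rewrite mem_pair_powerset => /andP[/= II JJ]; apply: IH.
  - by rewrite (leq_trans lt)// cA cB.
  - by rewrite (leq_trans (fsubset_leq_card II)).
  - by rewrite (leq_trans (fsubset_leq_card JJ)).
by rewrite (split_top I J)// -(split_top (upto #|` I|) (upto #|` J|)) ?card_upto.
Qed.

(** The ranges are independent of [a] and [b], since binomials with [r > a] or [c > b] vanish; this
    permits exchanging these sums with those over index sets. *)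
Lemma size_moebiusE a b : (a <= p)%N -> (b <= q)%N ->
  G a b = \sum_(r < p.+1) \sum_(c < q.+1) f r c *+ ('C(a, r) * 'C(b, c)).
Proof.
move=> ap bq; have := @eG (upto a) (upto b).
rewrite !card_upto => <-//.
have := @sum_card2 (upto a) (upto b); rewrite !card_upto => <-//.
apply: eq_big_seq => I; rewrite fpowersetE => /fsubset_leq_card; rewrite card_upto => Ia.
apply: eq_big_seq => J; rewrite fpowersetE => /fsubset_leq_card; rewrite card_upto => Jb.
by apply: size_moebius_card; [exact: leq_trans Ia ap|exact: leq_trans Jb bq].
Qed.

End size_moebius.

(** * Coefficients of the formula *)

Section Ustat_combinatorics.

Lemma mul_bin_sub m p r : (r <= p)%N -> (p <= m)%N ->
  ('C(m, r) * 'C(m - r, p - r) = 'C(m, p) * 'C(p, r))%N.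
Proof.
move=> rp pm; have rm := leq_trans rp pm.
apply/eqP; rewrite -(eqn_pmul2r (fact_gt0 r)) -(eqn_pmul2r (fact_gt0 (p - r))).
rewrite -(eqn_pmul2r (fact_gt0 (m - p))); apply/eqP.
have e1 := bin_fact rm; have e3 := bin_fact pm; have e4 := bin_fact rp.
have e2 : ('C(m - r, p - r) * ((p - r)`! * (m - p)`!) = (m - r)`!)%N.
  by have := @bin_fact (m - r) (p - r); rewrite subnBA// subnK// leq_sub2r// => /(_ isT).
transitivity (m`!)%N; first by rewrite -e1 -e2; ring.
by rewrite -e3 -e4; ring.
Qed.

(** Origin of the coefficient of a term: the normalisation of the two U-statistics times the count
    of [sum_bin_fsetI]. *)
Lemma norm_bin_fsetI (R : numFieldType) m p r : (r <= p)%N -> (p <= m)%N ->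
  'C(m, p)%:R^-1 ^+ 2 * ('C(m, r) * 'C(m - r, p - r) ^ 2)%:R =
  'C(p, r)%:R ^+ 2 * 'C(m, r)%:R^-1 :> R.
Proof.
move=> rp pm.
have a0 : ('C(m, r))%:R != 0 :> R by rewrite pnatr_eq0 -lt0n bin_gt0 (leq_trans rp).
have b0 : ('C(m, p))%:R != 0 :> R by rewrite pnatr_eq0 -lt0n bin_gt0.
have /(congr1 (fun n => n%:R : R)) := mul_bin_sub rp pm.
rewrite !natrM => e.
have -> : 'C(p, r)%:R = 'C(m, r)%:R * 'C(m - r, p - r)%:R / 'C(m, p)%:R :> R.
  by rewrite e mulrAC divff// mul1r.
by field; rewrite a0 b0.
Qed.

(** For fixed [(r, c)] the sum over quadruples of index sets factors into a row part and a column
    part, each a count over pairs. *)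
Lemma sum_Ustat_pairs (R : realFieldType) p q m n (f : nat -> nat -> R) :
  (p <= m)%N -> (q <= n)%N ->
  ('C(m, p)%:R^-1 * 'C(n, q)%:R^-1) ^+ 2 *
  (\sum_(I <- ksubsets p (upto m)) \sum_(J <- ksubsets q (upto n))
   \sum_(I' <- ksubsets p (upto m)) \sum_(J' <- ksubsets q (upto n))
   \sum_(r < p.+1) \sum_(c < q.+1)
     f r c *+ ('C(#|` (I `&` I')%fset|, r) * 'C(#|` (J `&` J')%fset|, c))) =
  \sum_(r < p.+1) \sum_(c < q.+1)
    'C(p, r)%:R ^+ 2 * 'C(q, c)%:R ^+ 2 * 'C(m, r)%:R^-1 * 'C(n, c)%:R^-1 * f r c.
Proof.
move=> pm qn.
pose b a r : R := 'C(a, r)%:R.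
transitivity (('C(m, p)%:R^-1 * 'C(n, q)%:R^-1) ^+ 2 *
  (\sum_(r < p.+1) \sum_(c < q.+1) f r c *
   ((\sum_(I <- ksubsets p (upto m)) \sum_(I' <- ksubsets p (upto m))
       b #|` (I `&` I')%fset| r) *
    (\sum_(J <- ksubsets q (upto n)) \sum_(J' <- ksubsets q (upto n))
       b #|` (J `&` J')%fset| c)))).
  congr (_ * _).
  transitivity (\sum_(I <- ksubsets p (upto m)) \sum_(I' <- ksubsets p (upto m))
   \sum_(J <- ksubsets q (upto n)) \sum_(J' <- ksubsets q (upto n))
   \sum_(r < p.+1) \sum_(c < q.+1)
     f r c * (b #|` (I `&` I')%fset| r * b #|` (J `&` J')%fset| c)).
    apply: eq_bigr => I _; rewrite exchange_big/=; apply: eq_bigr => I' _.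
    apply: eq_bigr => J _; apply: eq_bigr => J' _.
    apply: eq_bigr => r _; apply: eq_bigr => c _.
    by rewrite -mulr_natr natrM.
  pose S := ksubsets p (upto m); pose S' := ksubsets q (upto n).
  have ex4 (F : {fset nat} -> {fset nat} -> {fset nat} -> {fset nat} -> 'I_p.+1 -> 'I_q.+1 -> R) :
      \sum_(I <- S) \sum_(I' <- S) \sum_(J <- S') \sum_(J' <- S')
        \sum_(r < p.+1) \sum_(c < q.+1) F I I' J J' r c =
      \sum_(r < p.+1) \sum_(c < q.+1)
        \sum_(I <- S) \sum_(I' <- S) \sum_(J <- S') \sum_(J' <- S') F I I' J J' r c.
    have ex1 (A : seq {fset nat}) (H : {fset nat} -> 'I_p.+1 -> 'I_q.+1 -> R) :
        \sum_(I <- A) \sum_(r < p.+1) \sum_(c < q.+1) H I r c =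
        \sum_(r < p.+1) \sum_(c < q.+1) \sum_(I <- A) H I r c.
      by rewrite exchange_big; apply: eq_bigr => r _; rewrite exchange_big.
    rewrite -ex1; apply: eq_bigr => I _; rewrite -ex1; apply: eq_bigr => I' _.
    by rewrite -ex1; apply: eq_bigr => J _; rewrite -ex1.
  rewrite ex4; apply: eq_bigr => r _; apply: eq_bigr => c _.
  rewrite mulr_suml mulr_sumr; apply: eq_bigr => I _.
  rewrite mulr_suml mulr_sumr; apply: eq_bigr => I' _.
  rewrite !mulr_sumr; apply: eq_bigr => J _.
  by rewrite !mulr_sumr; apply: eq_bigr => J' _.
rewrite mulr_sumr; apply: eq_bigr => r _; rewrite mulr_sumr; apply: eq_bigr => c _.
have rp : (r <= p)%N by rewrite -ltnS.
have cq : (c <= q)%N by rewrite -ltnS.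
have sE k l t : (t <= k)%N -> (k <= l)%N ->
    \sum_(I <- ksubsets k (upto l)) \sum_(I' <- ksubsets k (upto l))
      b #|` (I `&` I')%fset| t = ('C(l, t) * 'C(l - t, k - t) ^ 2)%:R.
  move=> tk kl; rewrite -(sum_bin_fsetI tk kl) natr_sum; apply: eq_bigr => I _.
  by rewrite natr_sum.
have e1 := @norm_bin_fsetI R _ _ _ rp pm; have e2 := @norm_bin_fsetI R _ _ _ cq qn.
rewrite !sE//; move: e1 e2; set A := ('C(m, r) * _)%:R; set B := ('C(n, c) * _)%:R => e1 e2.
transitivity ((('C(m, p)%:R^-1 ^+ 2) * A) * (('C(n, q)%:R^-1 ^+ 2) * B) * f r c).
  by ring.
by rewrite e1 e2; ring.
Qed.

End Ustat_combinatorics.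

(** * The covariance formula *)

Section covariance_bilinear.
Context d (T : measurableType d) (R : realType) (P : probability T R).

Lemma covariance_fin_num2 (X Z : T -> R) : X \in Lfun P 2%:E -> Z \in Lfun P 2%:E ->
  covariance P X Z \is a fin_num.
Proof.
move=> X2 Z2; apply: covariance_fin_num; [exact: Lfun21|exact: Lfun21|].
exact: Lfun2_mul_Lfun1.
Qed.

Lemma Lfun_sum (I : eqType) (s : seq I) (X : I -> T -> R) :
  (forall i, i \in s -> X i \in Lfun P 2%:E) ->
  (fun w => \sum_(i <- s) X i w) \in Lfun P 2%:E.
Proof.
elim: s => [|i s IH] X2.
  rewrite (_ : (fun _ => _) = cst 0); first exact: Lfun_cst.
  by apply/funext => w; rewrite big_nil.
rewrite (_ : (fun _ => _) = X i \+ (fun w => \sum_(j <- s) X j w)); last first.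
  by apply/funext => w; rewrite big_cons.
rewrite rpredD ?lee1n//=; first by rewrite X2 ?mem_head.
by move=> _; apply: IH => j js; rewrite X2// inE js orbT.
Qed.

(** The covariances are supplied as reals [c i], so that sums are formed in [R] rather than among
    extended reals. *)
Lemma covariance_suml (I : eqType) (s : seq I) (X : I -> T -> R) (c : I -> R) (Z : T -> R) :
  (forall i, i \in s -> X i \in Lfun P 2%:E) -> Z \in Lfun P 2%:E ->
  (forall i, i \in s -> covariance P (X i) Z = (c i)%:E) ->
  covariance P (fun w => \sum_(i <- s) X i w) Z = (\sum_(i <- s) c i)%:E.
Proof.
move=> X2 Z2; elim: s X2 => [|i s IH] X2 cE.
  rewrite big_nil (_ : (fun _ => _) = cst 0) ?covariance_cst_l//.
  by apply/funext => w; rewrite big_nil.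
rewrite (_ : (fun _ => _) = X i \+ (fun w => \sum_(j <- s) X j w)); last first.
  by apply/funext => w; rewrite big_cons.
have sX2 j : j \in s -> X j \in Lfun P 2%:E by move=> js; apply: X2; rewrite inE js orbT.
rewrite covarianceDl//; [|by apply: X2; rewrite mem_head|exact: Lfun_sum].
rewrite IH//; last by move=> j js; apply: cE; rewrite inE js orbT.
by rewrite cE ?mem_head// big_cons EFinD.
Qed.

Lemma covariance_sum2 (I J : eqType) (s : seq I) (t : seq J) (X : I -> T -> R)
    (Z : J -> T -> R) (c : I -> J -> R) :
  (forall i, i \in s -> X i \in Lfun P 2%:E) ->
  (forall j, j \in t -> Z j \in Lfun P 2%:E) ->
  (forall i j, i \in s -> j \in t -> covariance P (X i) (Z j) = (c i j)%:E) ->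
  covariance P (fun w => \sum_(i <- s) X i w) (fun w => \sum_(j <- t) Z j w) =
  (\sum_(i <- s) \sum_(j <- t) c i j)%:E.
Proof.
move=> X2 Z2 cE; apply: covariance_suml => //; first exact: Lfun_sum.
move=> i iS; rewrite covarianceC; apply: covariance_suml => //; first exact: X2.
by move=> j jt; rewrite covarianceC; exact: cE.
Qed.

Lemma covariance_ae_eq (X X' Z Z' : T -> R) :
  measurable_fun setT X -> measurable_fun setT X' ->
  measurable_fun setT Z -> measurable_fun setT Z' ->
  {ae P, forall w, X w = X' w} -> {ae P, forall w, Z w = Z' w} ->
  covariance P X Z = covariance P X' Z'.
Proof.
move=> mX mX' mZ mZ' XX' ZZ'.
have E (f g : T -> R) : measurable_fun setT f -> measurable_fun setT g ->
    {ae P, forall w, f w = g w} -> ('E_P[f] = 'E_P[g])%E.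
  move=> mf mg fg; rewrite unlock; apply: ae_eq_integral => //.
  - exact/measurable_EFinP.
  - exact/measurable_EFinP.
  - by apply: filterS fg => w fgw _; rewrite fgw.
rewrite unlock (E X X')// (E Z Z')//; apply: E.
- by apply: measurable_funM; apply: measurable_funB.
- by apply: measurable_funM; apply: measurable_funB.
- by apply: filterS2 XX' ZZ' => w e1 e2; rewrite !fctE/= e1 e2.
Qed.

End covariance_bilinear.

Section pproj_sum.
Context (T : Type) (R : realType).
Variable psi : {fset nat} -> {fset nat} -> T -> R.

Definition pproj_at (x : {fset nat} * {fset nat}) : T -> R :=
  pproj psi #|` x.1| #|` x.2| x.1 x.2.

(** The recursion solved for [psi]: it subtracts all terms but the top one, and the only subsets of
    full size are [I] and [J] themselves. *)
Lemma psi_sum_pproj x w :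
  psi x.1 x.2 w = \sum_(y <- pair_powerset x) pproj_at y w.
Proof.
case: x => I J; rewrite big_pair_powerset /pproj_at/=.
pose S r c := \sum_(A <- ksubsets r I) \sum_(B <- ksubsets c J) pproj psi r c A B w.
have sumE : \sum_(A <- fpowerset I) \sum_(B <- fpowerset J) pproj psi #|` A| #|` B| A B w =
    \sum_(r < #|` I|.+1) \sum_(c < #|` J|.+1) S r c.
  rewrite (sum_fpowerset _ (leqnn _)); apply: eq_bigr => r _.
  rewrite exchange_big/= (sum_fpowerset _ (leqnn _)); apply: eq_bigr => c _.
  rewrite exchange_big/=; apply: eq_big_seq => A; rewrite in_ksubsets => /andP[_ /eqP ->].
  by apply: eq_big_seq => B; rewrite in_ksubsets => /andP[_ /eqP ->].
have SE : S #|` I| #|` J| = pproj psi #|` I| #|` J| I J w.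
  by rewrite /S !ksubsets_full !big_seq_fset1.
have := pprojE psi #|` I| #|` J| I J w.
under [X in _ - X]eq_bigr => r _ do under eq_bigr => c _ do rewrite -/(S r c).
move=> pE; rewrite sumE.
transitivity (S #|` I| #|` J| + \sum_(r < #|` I|.+1)
    \sum_(c < #|` J|.+1 | (r : nat, c : nat) != (#|` I|, #|` J|)) S r c).
  by rewrite SE pE subrK.
rewrite [RHS](eq_bigr (fun r : 'I_#|` I|.+1 =>
  \sum_(c < #|` J|.+1 | (r : nat, c : nat) == (#|` I|, #|` J|)) S r c +
  \sum_(c < #|` J|.+1 | (r : nat, c : nat) != (#|` I|, #|` J|)) S r c)); last first.
  move=> r _; exact: (bigID (fun c : 'I_#|` J|.+1 => (r : nat, c : nat) == (#|` I|, #|` J|))).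
rewrite big_split/=; congr (_ + _).
rewrite (bigD1 ord_max)//= (big_pred1 ord_max); last first.
  by move=> c; rewrite xpair_eqE eqxx/=; rewrite -(inj_eq val_inj).
rewrite big1 ?addr0// => r rn; apply: big_pred0 => c; rewrite xpair_eqE.
by rewrite -(inj_eq val_inj) /= in rn; rewrite (negbTE rn).
Qed.

End pproj_sum.

(** Induction on the total size: a projection is [psi] minus projections at strictly smaller
    pairs. *)
Lemma pproj_at_Lfun2 d (T : measurableType d) (R : realType) (P : probability T R)
    (psi : {fset nat} -> {fset nat} -> T -> R) p q :
  (forall I J : {fset nat}, (#|` I| <= p)%N -> (#|` J| <= q)%N -> psi I J \in Lfun P 2%:E) ->
  forall x : {fset nat} * {fset nat},
    (#|` x.1| <= p)%N -> (#|` x.2| <= q)%N -> pproj_at psi x \in Lfun P 2%:E.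
Proof.
move=> psi2 x; have [n] := ubnP (#|` x.1| + #|` x.2|).
elim: n x => // n IH x; rewrite ltnS => xn xp xq.
have xx : x \in pair_powerset x by rewrite mem_pair_powerset !fsubset_refl.
rewrite (_ : pproj_at psi x = psi x.1 x.2 \-
    (fun w => \sum_(y <- rem x (pair_powerset x)) pproj_at psi y w)); last first.
  by apply/funext => w /=; rewrite psi_sum_pproj (big_rem x xx) addrK.
rewrite rpredB ?lee1n//=; first by rewrite psi2.
move=> _; apply: Lfun_sum => y; rewrite mem_rem_uniq ?pair_powerset_uniq// inE => /andP[yx yd].
have := pair_powerset_card yd; rewrite (negbTE yx)/= => lt.
move: yd; rewrite mem_pair_powerset => /andP[y1 y2]; apply: IH.
- exact: leq_trans lt xn.
- exact: leq_trans (fsubset_leq_card y1) xp.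
- exact: leq_trans (fsubset_leq_card y2) xq.
Qed.

Theorem corollary3p2 (R : realType) (d : measure_display)
    (T : measurableType d) (P : probability T R)
    (Y : nat -> nat -> T -> R)
    (mY : forall i j, measurable_fun setT (Y i j))
    (Yrce : RCE P Y) (Ydis : dissociated P Y)
    (phi : R * R * R -> R)
    (xi eta : nat -> T -> R) (zeta : nat -> nat -> T -> R)
    (Yahk : AHK_representation P xi eta zeta Y phi)
    (p q : nat) (p_gt0 : (0 < p)%N) (q_gt0 : (0 < q)%N)
    (h1 h2 : 'M[R]_(p, q) -> R)
    (ker1 : kernel_function h1) (ker2 : kernel_function h2)
    (h1L2 : ('E_P[(fun w => kernel_at h1 Y (upto p) (upto q) w ^+ 2)%R] < +oo)%E)
    (h2L2 : ('E_P[(fun w => kernel_at h2 Y (upto p) (upto q) w ^+ 2)%R] < +oo)%E)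
    (psi1 psi2 : {fset nat} -> {fset nat} -> T -> R)
    (psi1P : is_psi P xi eta zeta h1 Y psi1)
    (psi2P : is_psi P xi eta zeta h2 Y psi2)
    (m n : nat) (le_pm : (p <= m)%N) (le_qn : (q <= n)%N) :
  covariance P (Ustat h1 Y m n) (Ustat h2 Y m n) =
  (\sum_(r < p.+1) \sum_(c < q.+1 | (r : nat, c : nat) != (0, 0)%N)
     ('C(p, r)%:R ^+ 2 * 'C(q, c)%:R ^+ 2 *
      'C(m, r)%:R^-1 * 'C(n, c)%:R^-1)%:E *
     covariance P (pproj psi1 r c (upto r) (upto c))
                  (pproj psi2 r c (upto r) (upto c)))%E.
Proof.
have [G [G00 covG]] := covariance_psi_version mY Yahk ker1 ker2 h1L2 h2L2 psi1P psi2P.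
have ver1 I J Ip Jq := @is_psi_version _ _ _ _ _ _ _ _ _ mY Yahk _ _ _ ker1 psi1 I J psi1P Ip Jq.
have ver2 I J Ip Jq := @is_psi_version _ _ _ _ _ _ _ _ _ mY Yahk _ _ _ ker2 psi2 I J psi2P Ip Jq.
have psi1L I J Ip Jq := psi_version_Lfun2 mY Yahk ker1 h1L2 Ip Jq (ver1 I J Ip Jq).
have psi2L I J Ip Jq := psi_version_Lfun2 mY Yahk ker2 h2L2 Ip Jq (ver2 I J Ip Jq).
have v1L := pproj_at_Lfun2 psi1L; have v2L := pproj_at_Lfun2 psi2L.
(* [psi1] and [psi2] are specified only for sizes up to [p] and [q]; [adm] keeps the inversion
   inside this range. *)
pose adm (x : {fset nat} * {fset nat}) := (#|` x.1| <= p)%N && (#|` x.2| <= q)%N.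
pose b x y := fine (covariance P (pproj_at psi1 x) (pproj_at psi2 y)).
have dn_adm x y : y \in pair_powerset x -> adm x -> adm y.
  rewrite mem_pair_powerset => /andP[/fsubset_leq_card y1 /fsubset_leq_card y2].
  by move=> /andP[x1 x2]; rewrite /adm (leq_trans y1 x1) (leq_trans y2 x2).
have covb x y : adm x -> adm y ->
    covariance P (pproj_at psi1 x) (pproj_at psi2 y) = (b x y)%:E.
  move=> /andP[x1 x2] /andP[y1 y2].
  by rewrite fineK// covariance_fin_num2//; [exact: v1L|exact: v2L].
pose meet (x y : {fset nat} * {fset nat}) := ((x.1 `&` y.1)%fset, (x.2 `&` y.2)%fset).
pose g (x : {fset nat} * {fset nat}) := G #|` x.1| #|` x.2|.
have bE x y : adm x -> adm y ->
    \sum_(x' <- pair_powerset x) \sum_(y' <- pair_powerset y) b x' y' = g (meet x y).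
  move=> ax ay; have /andP[x1 x2] := ax; have /andP[y1 y2] := ay.
  apply: EFin_inj; rewrite -(@covariance_sum2 _ _ _ P _ _ (pair_powerset x)
    (pair_powerset y) (pproj_at psi1) (pproj_at psi2) b).
  - rewrite /g /meet /= -(covG _ _ _ _ _ _ x1 x2 y1 y2 (ver1 _ _ x1 x2) (ver2 _ _ y1 y2)).
    by congr (covariance P _ _); apply/funext => w; rewrite psi_sum_pproj.
  - by move=> z /dn_adm/(_ ax)/andP[z1 z2]; exact: v1L.
  - by move=> z /dn_adm/(_ ay)/andP[z1 z2]; exact: v2L.
  - by move=> z z' /dn_adm/(_ ax) az /dn_adm/(_ ay) az'; exact: covb.
have diag := @moebius_diag R _ pair_powerset meet
  (fun x => #|` x.1| + #|` x.2|)%N adm pair_powerset_uniq _ _ _ pair_powerset_card dn_adm b g bE.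
have {}diag x : adm x -> \sum_(y <- pair_powerset x) b y y = g x.
  apply: diag.
  - by move=> y; rewrite mem_pair_powerset !fsubset_refl.
  - by move=> y z t; rewrite !mem_pair_powerset !fsubsetI andbACA.
  - by case=> y1 y2; rewrite /meet/= !fsetIid.
(* Only diagonal covariances survive; their sums over subsets depend on the sizes alone. *)
pose e I J := b (I, J) (I, J).
have eG (I J : {fset nat}) : (#|` I| <= p)%N -> (#|` J| <= q)%N ->
    \sum_(I' <- fpowerset I) \sum_(J' <- fpowerset J) e I' J' = G #|` I| #|` J|.
  move=> Ip Jq; rewrite -(big_pair_powerset (I, J) (fun y => b y y)).
  by apply: diag; rewrite /adm/= Ip Jq.
have GE := size_moebiusE eG.
have e00 : e fset0 fset0 = 0.
  by have := eG fset0 fset0; rewrite !cardfs0 !fpowerset0 !big_seq_fset1 G00; exact.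
pose X (h : 'M[R]_(p, q) -> R) := ahk_kernel phi xi eta zeta h.
pose S := [seq (A, B) | A <- ksubsets p (upto m), B <- ksubsets q (upto n)].
have SP (x : {fset nat} * {fset nat}) : x \in S -> (#|` x.1| = p) * (#|` x.2| = q).
  move=> /allpairsP[[A B] [/=]]; rewrite !in_ksubsets.
  by move=> /andP[_ /eqP cA] /andP[_ /eqP cB] ->.
pose k : R := 'C(m, p)%:R^-1 * 'C(n, q)%:R^-1.
pose V (h : 'M[R]_(p, q) -> R) (x : {fset nat} * {fset nat}) := k \o* X h x.1 x.2.
have UE (h : 'M[R]_(p, q) -> R) w :
    Ustat h Y m n w = \sum_(x <- S) kernel_at h Y x.1 x.2 w * k.
  by rewrite /Ustat -mulr_suml mulrC big_allpairs.
have measurable_U (h : 'M[R]_(p, q) -> R) : kernel_function h ->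
    measurable_fun setT (Ustat h Y m n).
  (* Every term of the sum must be measurable, also for [x] outside [S], where the sizes may be
     wrong; such terms are set to 0. *)
  move=> ker; rewrite (_ : Ustat h Y m n = fun w => \sum_(x <- S)
      if x \in S then kernel_at h Y x.1 x.2 w * k else 0); last first.
    by apply/funext => w; rewrite UE big_seq -big_mkcond.
  apply: measurable_sum => x; case: (boolP (x \in S)) => [/SP[x1 x2]|_] //.
  by apply: measurable_funM => //; exact: measurable_kernel_at.
have U_ae (h : 'M[R]_(p, q) -> R) :
    {ae P, forall w, Ustat h Y m n w = \sum_(x <- S) V h x w}.
  apply: filterS (kernel_at_ahk Yahk h) => w Yw; rewrite UE.
  by apply: eq_bigr => x _; rewrite Yw.
have XL (h : 'M[R]_(p, q) -> R) (ker : kernel_function h)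
    (hL2 : ('E_P[(fun w => kernel_at h Y (upto p) (upto q) w ^+ 2)%R] < +oo)%E) x :
    x \in S -> X h x.1 x.2 \in Lfun P 2%:E.
  by move=> /SP[x1 x2]; exact: (ahk_kernel_Lfun2 mY Yahk ker hL2).
have VL (h : 'M[R]_(p, q) -> R) (ker : kernel_function h)
    (hL2 : ('E_P[(fun w => kernel_at h Y (upto p) (upto q) w ^+ 2)%R] < +oo)%E) x :
    x \in S -> V h x \in Lfun P 2%:E.
  by move=> xS; apply: Lfun_scale; [rewrite ler1n|exact: XL].
(* Covariance ignores null sets, so the U-statistics may be computed from the kernels of the AHK
   variables. *)
rewrite (covariance_ae_eq _ _ _ _ (U_ae h1) (U_ae h2)); first last.
- exact: Lfun_measurable (Lfun_sum (VL h2 ker2 h2L2)).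
- exact: measurable_U.
- exact: Lfun_measurable (Lfun_sum (VL h1 ker1 h1L2)).
- exact: measurable_U.
rewrite (@covariance_sum2 _ _ _ P _ _ S S (V h1) (V h2)
  (fun x y => k ^+ 2 * G #|` (x.1 `&` y.1)%fset| #|` (x.2 `&` y.2)%fset|)); first last.
- move=> x y xS yS; have [x1 x2] := SP x xS; have [y1 y2] := SP y yS.
  have X1L := XL h1 ker1 h1L2 x xS; have X2L := XL h2 ker2 h2L2 y yS.
  have kX2L : V h2 y \in Lfun P 1 by apply: Lfun21; exact: VL.
  rewrite covarianceZl//; [|exact: Lfun21|by apply: Lfun2_mul_Lfun1 => //; exact: VL].
  rewrite covarianceZr//; [|exact: Lfun21|exact: Lfun21|exact: Lfun2_mul_Lfun1].
  (* Full-size kernels are their own projections, so [covG] applies to them. *)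
  rewrite (covG x.1 y.1 x.2 y.2) ?x1 ?x2 ?y1 ?y2// ?muleA ?expr2 ?EFinM//.
    exact: psi_version_ahk_kernel.
  exact: psi_version_ahk_kernel.
- exact: VL.
- exact: VL.
pose coef r c : R := 'C(p, r)%:R ^+ 2 * 'C(q, c)%:R ^+ 2 * 'C(m, r)%:R^-1 * 'C(n, c)%:R^-1.
transitivity (\sum_(r < p.+1) \sum_(c < q.+1) coef r c * e (upto r) (upto c))%:E.
  congr (_%:E); rewrite -[RHS](sum_Ustat_pairs (fun r c => e (upto r) (upto c)) le_pm le_qn).
  rewrite -/k mulr_sumr big_allpairs; apply: eq_big_seq => I Ip.
  rewrite mulr_sumr; apply: eq_big_seq => J Jq.
  rewrite big_allpairs mulr_sumr; apply: eq_bigr => I' _.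
  rewrite mulr_sumr; apply: eq_bigr => J' _; congr (_ * _); apply: GE.
    move: Ip; rewrite in_ksubsets => /andP[_ /eqP <-].
    by rewrite fsubset_leq_card// fsubsetIl.
  move: Jq; rewrite in_ksubsets => /andP[_ /eqP <-].
  by rewrite fsubset_leq_card// fsubsetIl.
rewrite -sumEFin; apply: eq_bigr => r _.
rewrite -sumEFin [RHS]big_mkcond; apply: eq_bigr => c _.
(* The term [(0, 0)], absent from the formula, is 0 by [e00]. *)
case: ifPn => [_|/negbNE/eqP[-> ->]]; last first.
  rewrite (_ : upto 0 = fset0) ?e00 ?mulr0//.
  by apply/fsetP => i; rewrite !inE.
have ad : adm (upto r, upto c) by rewrite /adm/= !card_upto !leq_ord.
have := covb _ _ ad ad; rewrite /pproj_at/= !card_upto => ->.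
exact: EFinM.
Qed.
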